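(* Let $(\mathcal A,\mathcal T,(-),\preceq)$ be any tangibly balanced system satisfying tangible balance elimination. Then $\mathcal T_0$ becomes a multiring under the hyperaddition $$\mathop{\boxplus_\nabla}_{i=1}^{t} S_i=\Big\{a\in\mathcal T_0:\ a\,\nabla\,\textstyle\sum_{i=1}^tS_i\Big\}$$ (for $S_i\subseteq\mathcal T_0$, elements being identified with singletons) and the multiplication of $\mathcal T_0$. Furthermore, when $(\mathcal A,\mathcal T,(-),\preceq)$ satisfies $\nabla$-inversion, $\mathcal T_0$ becomes a hyperring. Let $(\mathsf{TBSr},\preceq)$, $\mathsf{Hp}$ and $\Phi:\mathsf{Hp}\to(\mathsf{TBSr},\preceq)$ be as in the context, and let $\Psi$ be the functor from $(\mathsf{TBSr},\preceq)$ to $\mathsf{Hp}$ sending $(\mathcal A,\mathcal T,(-),\preceq)$ to the hyperring $(\mathcal T_0,\boxplus_\nabla,\cdot)$ and sending a $\preceq$-morphism to a morphism of hyperrings. Then $\Psi\Phi$ is the identity on $\mathsf{Hp}$, so $\Phi$ exhibits $\mathsf{Hp}$ as a full reflective subcategory of $(\mathsf{TBSr},\preceq)$.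
   Context: **Systems.** Let $(\mathcal A,+,0)$ be a commutative additive monoid with a subset $\mathcal T\subset\mathcal A$, $0\notin\mathcal T$ (tangible elements), $\mathcal T_0=\mathcal T\cup\{0\}$. $\mathcal A$ is a $\mathcal T$-gen bimodule if $\mathcal T_0$ is a multiplicative monoid with unit $1\in\mathcal T$, additively generates $\mathcal A$, and acts on $\mathcal A$ on the left with $(a_1a_2)b=a_1(a_2b)$, $0b=0$, $1b=b$, $a1=a$, $a0=0$, $a\sum b_i=\sum ab_i$ ($a,a_i\in\mathcal T_0$, $b,b_i\in\mathcal A$), and likewise on the right. A negation map is an additive isomorphism $(-):\mathcal A\to\mathcal A$ of order $\le2$ with $(-)1\in\mathcal T$ and $((-)a)b=(-)(ab)=a((-)b)$ for $a\in\mathcal T,b\in\mathcal A$ (similarly on the right). Write $b(-)c=b+((-)c)$, $b^\circ=b(-)b$, $\mathcal A^\circ=\{b^\circ:b\in\mathcal A\}$. A triple $(\mathcal A,\mathcal T,(-))$ is a $\mathcal T$-gen bimodule with a negation map such that $\mathcal A^\circ\cap\mathcal T=\emptyset$. A surpassing relation $\preceq$ is a reflexive transitive relation with: $b\preceq0\Rightarrow b=0$; $0\preceq b^\circ$; $b_i\preceq b_i'$ ($i=1,2$) implies $a_1b_1+a_2b_2\preceq a_1b_1'+a_2b_2'$ and $b_1a_1+b_2a_2\preceq b_1'a_1+b_2'a_2$ for $a_i\in\mathcal T$; $a\preceq a'$ with $a,a'\in\mathcal T_0$ implies $a=a'$. Put $\mathcal A_{\rm Null}=\{b:0\preceq b\}$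 and write $b\nabla b'$ if $b(-)b'\in\mathcal A_{\rm Null}$. A system $(\mathcal A,\mathcal T,(-),\preceq)$ is a triple with a surpassing relation such that $a\nabla a'$ with $a,a'\in\mathcal T$ implies $a=a'$. It is an nd-semiring system if $\mathcal A$ is moreover a multiplicative monoid with unit $1$ and absorbing $0$, whose multiplication restricts to the $\mathcal T_0$-actions, and $b_i\preceq b_i'$ implies $b_1b_2\preceq b_1'b_2'$. An nd-semiring system is of hyper-type if whenever $\sum_ib_ib_i'\in\mathcal A_{\rm Null}$ there are $a_i,a_i'\in\mathcal T_0$ with $a_i\preceq b_i$, $a_i'\preceq b_i'$, $\sum_ia_ia_i'\in\mathcal A_{\rm Null}$. **Balancing.** For $a\in\mathcal A$ and $S\subseteq\mathcal A$, $a\nabla S$ means $a\nabla b$ for some $b\in S$; $S_1+S_2=\{s_1+s_2:s_i\in S_i\}$. The system is tangibly balanced if whenever $b_1\nabla b_2$ there is $a\in\mathcal T_0$ with $b_i\nabla a$ for $i=1,2$. It has tangible balance elimination if for $a\in\mathcal T_0$, $b_i\in\mathcal A$, $b_1\nabla a$ and $a\nabla b_2$ imply $b_1\nabla b_2$. It has left $\nabla$-inversion if $ab\nabla a_1$ for $a,a_1\in\mathcal T_0$, $b\in\mathcal A$ implies there is $b'\in\mathcal T_0$ with $ab'=a_1$ and $b\nabla b'$; right $\nabla$-inversion is analogous; $\nabla$-inversion means both. **Hyperrings.** A hypergroup $(\mathcal H,\boxplus,0)$ is a set with a commutative operation $\boxplus:\mathcal H\times\mathcal H\to\mathcal P^*(\mathcal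 H)$ (nonempty subsets), associative when extended by $a\boxplus S=\bigcup_{s\in S}a\boxplus s$, with $0\boxplus a=\{a\}$, every $a$ having a unique $-a$ with $0\in a\boxplus(-a)$, and reversible: $a_1\in a_2\boxplus a_3$ iff $a_3\in a_1\boxplus(-a_2)$. A multiring is a hypergroup that is also a multiplicative monoid $(\mathcal H,\cdot,1)$ with $0$ absorbing and $a(\boxplus_is_i)\subseteq\boxplus_i(as_i)$ for $a,s_i\in\mathcal H$. A hyperring is a multiring in which equality always holds in this inclusion. **Categories.** $\mathsf{Hp}$: objects are hyperrings, morphisms are multiplicative maps $f$ (with $f(0)=0'$, $f(1)=1'$) with $f(\boxplus a_i)\subseteq\boxplus'f(a_i)$. A $\preceq$-morphism of systems is a map $f:\mathcal A\to\mathcal A'$ restricting to a monoid homomorphism $\mathcal T\to\mathcal T'$ with $f(0)=0'$, $f(ab)=f(a)f(b)$, $f(ba)=f(b)f(a)$ ($a\in\mathcal T,b\in\mathcal A$), $b_1\preceq b_2\Rightarrow f(b_1)\preceq'f(b_2)$ and $f(b_1+b_2)\preceq'f(b_1)+f(b_2)$. $(\mathsf{TBSr},\preceq)$: objects are the tangibly balanced nd-semiring systems satisfying tangible balance elimination and $\nabla$-inversion with $\preceq$ of hyper-type; morphisms are $\preceq$-morphisms. The functor $\Phi$ sends a hyperring $\mathcal H$ to its hypersystem $(\overline{\mathcal H},\mathcal H\setminus\{0\},(-),\subseteq)$, where $\overline{\mathcal H}$ is the additive submonoid of $(\mathcal P^*(\mathcal H),\boxplus)$ generated by the singletons (identified with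 the elements of $\mathcal H$), $S_1\boxplus S_2=\bigcup\{s_1\boxplus s_2:s_i\in S_i\}$, zero is $\{0\}$, $(-)S=\{-s:s\in S\}$, the action is $aS=\{as:s\in S\}$ and the multiplication is $S_1S_2=\{s_1s_2:s_i\in S_i\}$; a hyperring morphism $f$ is sent to $S\mapsto\{f(s):s\in S\}$. A subcategory $\mathfrak C$ of $\mathfrak D$ is reflective if for each object $D$ of $\mathfrak D$ there are an object $C_D$ of $\mathfrak C$ and a $\mathfrak D$-morphism $r_D:D\to C_D$ such that each $\mathfrak D$-morphism $f:D\to C$ with $C$ in $\mathfrak C$ equals $\bar f\circ r_D$ for a unique $\mathfrak C$-morphism $\bar f:C_D\to C$.
   Formalization: Hp is cut to two-sided hyperrings with 1≠0 and morphisms on which Φ is defined (products, images of finite hypersums are hypersums); TBSr morphisms act T₀→T₀' and, for full reflectivity, tangible elements below f(b) must lift below b; literally Φ is undefined or not full. ΨΦ=id via a↦{a}. *)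

(* Defs.v *)
From HB Require Import structures.
From mathcomp Require Import all_boot all_algebra.
From mathcomp Require Import boolp classical_sets.

Set Implicit Arguments.
Unset Strict Implicit.
Unset Printing Implicit Defensive.

Import GRing.Theory.
Local Open Scope classical_set_scope.
Local Open Scope ring_scope.

Definition tan0 (A : nmodType) (T : set A) : set A := [set 0] `|` T.

(* The products with tangible elements are three operations: on T_0, from T_0
   to A on the left, and on the right.  The bimodule axioms force them to
   agree on T_0, e.g. a a' = (a a') 1 = a (a' 1) = a a'. *)
Record sysdata := SysData {
  scar :> nmodType;
  tang : set scar;
  tone : tan0 tang;
  tmul : tan0 tang -> tan0 tang -> tan0 tang;
  lact : tan0 tang -> scar -> scar;
  ract : scar -> tan0 tang -> scar;
  sneg : scar -> scar;
  sle : scar -> scar -> Prop }.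

Arguments tang : clear implicits.
Arguments tone : clear implicits.

Definition T0 (A : sysdata) : Type := tan0 (tang A).
Definition tv (A : sysdata) (a : T0 A) : A := val a.
Definition tzero (A : sysdata) : T0 A :=
  SigSub (mem_set (or_introl erefl : tan0 (tang A) 0)).

Notation "a '*l' b" := (lact a b) (at level 40, left associativity).
Notation "b '*r' a" := (ract b a) (at level 40, left associativity).
Notation "b '⪯' b'" := (sle b b') (at level 70, no associativity).

Record is_Tgen_bimodule (A : sysdata) : Prop := {
  tang_n0 : ~ tang A 0;
  tang_1 : tang A (tv (tone A));
  tmulA : associative (@tmul A);
  tmul1x : left_id (tone A) (@tmul A);
  tmulx1 : right_id (tone A) (@tmul A);
  tang_gen : forall b : A, exists s : seq (T0 A), b = \sum_(a <- s) tv a;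
  lactA : forall (a1 a2 : T0 A) (b : A), tmul a1 a2 *l b = a1 *l (a2 *l b);
  lact0x : forall b : A, tzero A *l b = 0;
  lact1x : forall b : A, tone A *l b = b;
  lactx1 : forall a : T0 A, a *l tv (tone A) = tv a;
  lactx0 : forall a : T0 A, a *l (0 : A) = 0;
  lact_sum : forall (a : T0 A) (s : seq A),
    a *l (\sum_(b <- s) b) = \sum_(b <- s) a *l b;
  ractA : forall (a1 a2 : T0 A) (b : A), b *r tmul a1 a2 = (b *r a1) *r a2;
  ractx0 : forall b : A, b *r tzero A = 0;
  ractx1 : forall b : A, b *r tone A = b;
  ract1x : forall a : T0 A, tv (tone A) *r a = tv a;
  ract0x : forall a : T0 A, (0 : A) *r a = 0;
  ract_sum : forall (a : T0 A) (s : seq A),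
    (\sum_(b <- s) b) *r a = \sum_(b <- s) b *r a }.

Record is_negation_map (A : sysdata) : Prop := {
  sneg0 : @sneg A 0 = 0;
  snegD : forall b b' : A, sneg (b + b') = sneg b + sneg b';
  snegK : involutive (@sneg A);
  sneg_one : tang A (sneg (tv (tone A)));
  sneg_tan : forall a : T0 A, tang A (tv a) ->
    exists2 a' : T0 A, tv a' = sneg (tv a) &
      forall b : A, a' *l b = sneg (a *l b) /\ b *r a' = sneg (b *r a);
  sneg_lact : forall (a : T0 A) (b : A), tang A (tv a) ->
    a *l sneg b = sneg (a *l b);
  sneg_ract : forall (a : T0 A) (b : A), tang A (tv a) ->
    sneg b *r a = sneg (b *r a) }.

Definition is_triple (A : sysdata) : Prop :=
  [/\ is_Tgen_bimodule A, is_negation_map A &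
      forall b : A, ~ tang A (b + sneg b)].

Record is_surpassing (A : sysdata) : Prop := {
  sle_refl : forall b : A, b ⪯ b;
  sle_trans : forall b1 b2 b3 : A, b1 ⪯ b2 -> b2 ⪯ b3 -> b1 ⪯ b3;
  sle_x0 : forall b : A, b ⪯ 0 -> b = 0;
  sle_0circ : forall b : A, 0 ⪯ b + sneg b;
  sle_lact : forall (a1 a2 : T0 A) (b1 b2 b1' b2' : A),
    tang A (tv a1) -> tang A (tv a2) -> b1 ⪯ b1' -> b2 ⪯ b2' ->
    a1 *l b1 + a2 *l b2 ⪯ a1 *l b1' + a2 *l b2';
  sle_ract : forall (a1 a2 : T0 A) (b1 b2 b1' b2' : A),
    tang A (tv a1) -> tang A (tv a2) -> b1 ⪯ b1' -> b2 ⪯ b2' ->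
    b1 *r a1 + b2 *r a2 ⪯ b1' *r a1 + b2' *r a2;
  sle_tan : forall a a' : T0 A, tv a ⪯ tv a' -> a = a' }.

Definition Null (A : sysdata) : set A := [set b | 0 ⪯ b].

Definition nabla (A : sysdata) (b b' : A) : Prop := Null (b + sneg b').
Notation "b '∇' b'" := (nabla b b') (at level 70, no associativity).

Definition is_system (A : sysdata) : Prop :=
  [/\ is_triple A, is_surpassing A &
      forall a a' : T0 A, tang A (tv a) -> tang A (tv a') ->
        tv a ∇ tv a' -> a = a'].

Definition tangibly_balanced (A : sysdata) : Prop :=
  forall b1 b2 : A, b1 ∇ b2 -> exists a : T0 A, b1 ∇ tv a /\ b2 ∇ tv a.

Definition tangible_balance_elimination (A : sysdata) : Prop :=
  forall (a : T0 A) (b1 b2 : A), b1 ∇ tv a -> tv a ∇ b2 -> b1 ∇ b2.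

Definition left_nabla_inversion (A : sysdata) : Prop :=
  forall (a a1 : T0 A) (b : A), a *l b ∇ tv a1 ->
    exists b' : T0 A, tmul a b' = a1 /\ b ∇ tv b'.

Definition right_nabla_inversion (A : sysdata) : Prop :=
  forall (a a1 : T0 A) (b : A), b *r a ∇ tv a1 ->
    exists b' : T0 A, tmul b' a = a1 /\ b ∇ tv b'.

Definition nabla_inversion (A : sysdata) : Prop :=
  left_nabla_inversion A /\ right_nabla_inversion A.

Record ndsysdata := NdSysData {
  ndsys :> sysdata;
  ndmul : ndsys -> ndsys -> ndsys }.

Record is_nd_semiring_system (A : ndsysdata) : Prop := {
  nd_system : is_system A;
  ndmulA : associative (@ndmul A);
  ndmul1x : left_id (tv (tone A)) (@ndmul A);
  ndmulx1 : right_id (tv (tone A)) (@ndmul A);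
  ndmul0x : left_zero 0 (@ndmul A);
  ndmulx0 : right_zero 0 (@ndmul A);
  ndmul_lact : forall (a : T0 A) (b : A), ndmul (tv a) b = a *l b;
  ndmul_ract : forall (a : T0 A) (b : A), ndmul b (tv a) = b *r a;
  ndmul_sle : forall b1 b2 b1' b2' : A,
    b1 ⪯ b1' -> b2 ⪯ b2' -> ndmul b1 b2 ⪯ ndmul b1' b2' }.

Definition hyper_type (A : ndsysdata) : Prop :=
  forall (n : nat) (b b' : 'I_n -> A),
    Null (\sum_(i < n) ndmul (b i) (b' i)) ->
    exists a a' : 'I_n -> T0 A,
      (forall i, tv (a i) ⪯ b i /\ tv (a' i) ⪯ b' i) /\
      Null (\sum_(i < n) tv (tmul (a i) (a' i))).

Record hyperdata := HyperData {
  hcar :> Type;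
  hadd : hcar -> hcar -> set hcar;
  hzero : hcar;
  hmul : hcar -> hcar -> hcar;
  hone : hcar }.

Arguments hzero : clear implicits.
Arguments hone : clear implicits.

Section HyperDefs.
Variable H : hyperdata.

Definition setadd (S1 S2 : set H) : set H :=
  \bigcup_(x in S1) \bigcup_(y in S2) hadd x y.

Definition setmul (S1 S2 : set H) : set H :=
  [set hmul x y | x in S1 & y in S2].

Definition hsum (S : seq (set H)) : set H := foldr setadd [set hzero H] S.

Definition hsum1 (s : seq H) : set H := hsum [seq [set x] | x <- s].

Definition is_opp (a b : H) : Prop := hadd a b (hzero H).

Definition setopp (S : set H) : set H := [set y | exists2 x, S x & is_opp x y].

Record is_hypergroup : Prop := {
  hadd_ne : forall a b : H, hadd a b !=set0;
  haddC : forall a b : H, hadd a b = hadd b a;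
  haddA : forall a b c : H,
    setadd [set a] (hadd b c) = setadd (hadd a b) [set c];
  hadd0 : forall a : H, hadd (hzero H) a = [set a];
  hopp_ex : forall a : H, exists! b : H, is_opp a b;
  hadd_rev : forall a1 a2 a3 a2' : H, is_opp a2 a2' ->
    (hadd a2 a3 a1 <-> hadd a1 a2' a3) }.

Record is_premultiring : Prop := {
  hypergroupP : is_hypergroup;
  hmulA : associative (@hmul H);
  hmul1x : left_id (hone H) (@hmul H);
  hmulx1 : right_id (hone H) (@hmul H);
  hmul0x : left_zero (hzero H) (@hmul H);
  hmulx0 : right_zero (hzero H) (@hmul H) }.

Definition is_multiring : Prop :=
  is_premultiring /\
  forall (a : H) (s : seq H),
    hmul a @` hsum1 s `<=` hsum1 [seq hmul a x | x <- s] /\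
    (fun x => hmul x a) @` hsum1 s `<=` hsum1 [seq hmul x a | x <- s].

Definition is_hyperring : Prop :=
  is_multiring /\
  forall (a : H) (s : seq H),
    hmul a @` hsum1 s = hsum1 [seq hmul a x | x <- s] /\
    (fun x => hmul x a) @` hsum1 s = hsum1 [seq hmul x a | x <- s].

End HyperDefs.

Record is_hyp_iso (H H' : hyperdata) (f : H -> H') : Prop := {
  hi_bij : bijective f;
  hi_0 : f (hzero H) = hzero H';
  hi_1 : f (hone H) = hone H';
  hi_mul : forall x y : H, f (hmul x y) = hmul (f x) (f y);
  hi_add : forall x y : H, f @` hadd x y = hadd (f x) (f y) }.

Definition sumset (A : nmodType) (S : seq (set A)) : set A :=
  foldr (fun S1 S2 => [set x + y | x in S1 & y in S2]) [set 0] S.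

Definition nabla_set (A : sysdata) (a : A) (S : set A) : Prop :=
  exists2 b, S b & a ∇ b.

Definition boxnabla (A : sysdata) (S : seq (set (T0 A))) : set (T0 A) :=
  [set a | nabla_set (tv a) (sumset [seq @tv A @` Si | Si <- S])].

Definition nabla_hyper (A : sysdata) : hyperdata := {|
  hcar := T0 A;
  hadd := fun a b => boxnabla [:: [set a]; [set b]];
  hzero := tzero A;
  hmul := @tmul A;
  hone := tone A |}.

Record category := Category {
  obj :> Type;
  mor : obj -> obj -> Type;
  idm : forall X, mor X X;
  comp : forall X Y Z, mor Y Z -> mor X Y -> mor X Z;
  compm1 : forall X Y (f : mor X Y), comp f (idm X) = f;
  comp1m : forall X Y (f : mor X Y), comp (idm Y) f = f;
  compmA : forall X Y Z W (h : mor Z W) (g : mor Y Z) (f : mor X Y),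
    comp h (comp g f) = comp (comp h g) f }.

Record functor (C D : category) := Functor {
  fobj :> C -> D;
  fmor : forall X Y : C, mor X Y -> mor (fobj X) (fobj Y);
  fmor_id : forall X : C, fmor (idm X) = idm (fobj X);
  fmor_comp : forall (X Y Z : C) (g : mor Y Z) (f : mor X Y),
    fmor (comp g f) = comp (fmor g) (fmor f) }.

Definition faithful (C D : category) (F : functor C D) : Prop :=
  forall (X Y : C) (f g : mor X Y), fmor F f = fmor F g -> f = g.

Definition full (C D : category) (F : functor C D) : Prop :=
  forall (X Y : C) (g : mor (F X) (F Y)), exists f : mor X Y, fmor F f = g.

Definition reflective (C D : category) (F : functor C D) : Prop :=
  forall Y : D, exists (X0 : C) (r : mor Y (F X0)),
    forall (X : C) (f : mor Y (F X)),
      exists! f' : mor X0 X, f = comp (fmor F f') r.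

Definition full_reflective (C D : category) (F : functor C D) : Prop :=
  [/\ faithful F, full F & reflective F].

Section Subcategory.
Variables (C : category) (O : Type) (i : O -> C).
Variable Q : forall X Y : O, mor (i X) (i Y) -> Prop.
Hypothesis Q_id : forall X, Q (idm (i X)).
Hypothesis Q_comp : forall X Y Z (g : mor (i Y) (i Z)) (f : mor (i X) (i Y)),
  Q g -> Q f -> Q (comp g f).

Definition subcat_hom (X Y : O) : Type := {f : mor (i X) (i Y) | Q f}.
Definition subcat_id (X : O) : subcat_hom X X := exist _ _ (Q_id X).
Definition subcat_comp (X Y Z : O) (g : subcat_hom Y Z) (f : subcat_hom X Y) :
  subcat_hom X Z := exist _ _ (Q_comp (proj2_sig g) (proj2_sig f)).

Lemma subcat_ext (X Y : O) (f g : subcat_hom X Y) :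
  proj1_sig f = proj1_sig g -> f = g.
Proof. by case: f g => [f p] [g q] /= e; apply: eq_exist. Qed.

Program Definition subcat : category :=
  @Category O subcat_hom subcat_id subcat_comp _ _ _.
Next Obligation. by apply: subcat_ext; apply: compm1. Qed.
Next Obligation. by apply: subcat_ext; apply: comp1m. Qed.
Next Obligation. by apply: subcat_ext; apply: compmA. Qed.

End Subcategory.

Record is_TBSr (A : ndsysdata) : Prop := {
  TBSr_nd : is_nd_semiring_system A;
  TBSr_bal : tangibly_balanced A;
  TBSr_elim : tangible_balance_elimination A;
  TBSr_inv : nabla_inversion A;
  TBSr_hyp : hyper_type A }.

Record TBSr_obj := TBSrObj { tbdata :> ndsysdata; tbP : is_TBSr tbdata }.

(* g is the restriction of f to tangible elements.  It is a map on T_0, not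
   on T: only T_0 is a monoid, and hyperring morphisms may have a kernel. *)
Record is_sle_mor (A A' : sysdata) (f : A -> A') (g : T0 A -> T0 A') : Prop := {
  sm_restr : forall a : T0 A, f (tv a) = tv (g a);
  sm_0 : f 0 = 0;
  sm_1 : g (tone A) = tone A';
  sm_tmul : forall a b : T0 A, g (tmul a b) = tmul (g a) (g b);
  sm_lact : forall (a : T0 A) (b : A), f (a *l b) = g a *l f b;
  sm_ract : forall (a : T0 A) (b : A), f (b *r a) = f b *r g a;
  sm_mono : forall b1 b2 : A, b1 ⪯ b2 -> f b1 ⪯ f b2;
  sm_add : forall b1 b2 : A, f (b1 + b2) ⪯ f b1 + f b2 }.

Record sle_mor (A A' : sysdata) := SleMor {
  smfun :> A -> A';
  smtan : T0 A -> T0 A';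
  smP : is_sle_mor smfun smtan }.

Lemma sle_mor_ext (A A' : sysdata) (f g : sle_mor A A') : f =1 g -> f = g.
Proof.
case: f g => [f f' fP] [g g' gP] /= /funext e; subst g.
have e : f' = g'.
  apply/funext => a; apply: val_inj.
  by have := sm_restr gP a; rewrite (sm_restr fP).
by subst g'; rewrite (Prop_irrelevance fP gP).
Qed.

Lemma sle_mor_idP (A : TBSr_obj) : is_sle_mor (@id A) (@id (T0 A)).
Proof.
have [_ hs _] := nd_system (TBSr_nd (tbP A)).
by split=> // b1 b2; apply: sle_refl.
Qed.

Lemma sle_mor_compP (A B C : TBSr_obj) (g : sle_mor B C) (f : sle_mor A B) :
  is_sle_mor (g \o f) (smtan g \o smtan f).
Proof.
have [_ hs _] := nd_system (TBSr_nd (tbP C)).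
case: g f => [g g' gP] [f f' fP]; split=> /=.
- by move=> a; rewrite (sm_restr fP) (sm_restr gP).
- by rewrite (sm_0 fP) (sm_0 gP).
- by rewrite (sm_1 fP) (sm_1 gP).
- by move=> a b; rewrite (sm_tmul fP) (sm_tmul gP).
- by move=> a b; rewrite (sm_lact fP) (sm_lact gP).
- by move=> a b; rewrite (sm_ract fP) (sm_ract gP).
- by move=> b1 b2 /(sm_mono fP)/(sm_mono gP).
- move=> b1 b2; apply: (sle_trans hs) (sm_add gP _ _).
  exact: (sm_mono gP) (sm_add fP _ _).
Qed.

Program Definition TBSr : category :=
  @Category TBSr_obj (fun A B => sle_mor A B)
    (fun A => SleMor (sle_mor_idP A))
    (fun A B C g f => SleMor (sle_mor_compP g f)) _ _ _.
Next Obligation. by apply: sle_mor_ext. Qed.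
Next Obligation. by apply: sle_mor_ext. Qed.
Next Obligation. by apply: sle_mor_ext. Qed.

(* The zero ring is excluded: its hypersystem would have no tangible 1. *)
Definition is_Hp (H : hyperdata) : Prop := is_hyperring H /\ hone H <> hzero H.

Record Hp_obj := HpObj { hpdata :> hyperdata; hpP : is_Hp hpdata }.

Record is_hyp_mor (H H' : hyperdata) (f : H -> H') : Prop := {
  hm_0 : f (hzero H) = hzero H';
  hm_1 : f (hone H) = hone H';
  hm_mul : forall x y : H, f (hmul x y) = hmul (f x) (f y);
  hm_sum : forall s : seq H, f @` hsum1 s `<=` hsum1 [seq f x | x <- s] }.

Record hyp_mor (H H' : hyperdata) := HypMor {
  hmfun :> H -> H';
  hmP : is_hyp_mor hmfun }.

Lemma hyp_mor_ext (H H' : hyperdata) (f g : hyp_mor H H') : f =1 g -> f = g.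
Proof.
case: f g => [f fP] [g gP] /= /funext e; subst g.
by rewrite (Prop_irrelevance fP gP).
Qed.

Lemma hyp_mor_idP (H : hyperdata) : is_hyp_mor (@id H).
Proof. by split=> // s x [y ys <-]; rewrite map_id. Qed.

Lemma hyp_mor_compP (H1 H2 H3 : hyperdata)
  (g : hyp_mor H2 H3) (f : hyp_mor H1 H2) : is_hyp_mor (g \o f).
Proof.
case: g f => [g gP] [f fP]; split=> /=.
- by rewrite (hm_0 fP) (hm_0 gP).
- by rewrite (hm_1 fP) (hm_1 gP).
- by move=> x y; rewrite (hm_mul fP) (hm_mul gP).
- move=> s z [x xs <-]; rewrite map_comp; apply: (hm_sum gP).
  by exists (f x) => //; apply: (hm_sum fP); exists x.
Qed.

Program Definition Hp : category :=
  @Category Hp_obj (fun H K => hyp_mor H K)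
    (fun H => HypMor (hyp_mor_idP H))
    (fun H1 H2 H3 g f => HypMor (hyp_mor_compP g f)) _ _ _.
Next Obligation. by apply: hyp_mor_ext. Qed.
Next Obligation. by apply: hyp_mor_ext. Qed.
Next Obligation. by apply: hyp_mor_ext. Qed.

(* The proofs that balance hyperrings and restrictions of morphisms belong
   to Hp are arguments. *)
Section Psi.
Hypothesis PsiO : forall A : TBSr, is_Hp (nabla_hyper A).
Hypothesis PsiM : forall (A B : TBSr) (f : mor A B),
  @is_hyp_mor (nabla_hyper A) (nabla_hyper B) (smtan f).

Program Definition Psi : functor TBSr Hp :=
  @Functor TBSr Hp (fun A => HpObj (PsiO A))
    (fun A B f => HypMor (PsiM f)) _ _.
Next Obligation. by apply: hyp_mor_ext. Qed.
Next Obligation. by apply: hyp_mor_ext. Qed.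

End Psi.

Record hbar (H : hyperdata) := Hbar {
  hset :> set H;
  hsetP : exists s : seq H, hset = hsum1 s }.

Lemma hbar_ext (H : hyperdata) (S S' : hbar H) : (S : set H) = S' -> S = S'.
Proof.
by case: S S' => [S p] [S' p'] /= e; subst S'; rewrite (Prop_irrelevance p p').
Qed.

HB.instance Definition _ (H : hyperdata) := gen_eqMixin (hbar H).
HB.instance Definition _ (H : hyperdata) := gen_choiceMixin (hbar H).

Section SetAdd.
Variable H : hyperdata.
Hypothesis hH : is_hypergroup H.

Lemma setaddP (S1 S2 : set H) (z : H) :
  setadd S1 S2 z <-> exists x y, [/\ S1 x, S2 y & hadd x y z].
Proof.
split; first by move=> [x S1x [y S2y h]]; exists x, y.
by move=> [x [y [S1x S2y h]]]; exists x => //; exists y.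
Qed.

Lemma setaddC (S1 S2 : set H) : setadd S1 S2 = setadd S2 S1.
Proof.
by apply/seteqP; split=> z /setaddP[x [y [h1 h2 h]]]; apply/setaddP;
  exists y, x; split=> //; rewrite (haddC hH).
Qed.

Lemma setadd0 (S : set H) : setadd [set hzero H] S = S.
Proof.
apply/seteqP; split=> z.
  by move=> /setaddP[x [y [-> Sy]]]; rewrite (hadd0 hH) => ->.
by move=> Sz; apply/setaddP; exists (hzero H), z; rewrite (hadd0 hH).
Qed.

Lemma setaddA (S1 S2 S3 : set H) :
  setadd S1 (setadd S2 S3) = setadd (setadd S1 S2) S3.
Proof.
apply/seteqP; split=> z /setaddP[x [y [h1 h2 h]]].
  move/setaddP: h2 => [u [v [h2 h3 h4]]].
  have : setadd [set x] (hadd u v) z by apply/setaddP; exists x, y.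
  rewrite (haddA hH) => /setaddP[a [b [ha -> hb]]].
  by apply/setaddP; exists a, v; split=> //; apply/setaddP; exists x, u.
move/setaddP: h1 => [u [v [h1 h3 h4]]].
have : setadd (hadd u v) [set y] z by apply/setaddP; exists x, y.
rewrite -(haddA hH) => /setaddP[a [b [-> hb hz]]].
by apply/setaddP; exists u, b; split=> //; apply/setaddP; exists v, y.
Qed.

Lemma hsum1_cat (s t : seq H) : hsum1 (s ++ t) = setadd (hsum1 s) (hsum1 t).
Proof.
elim: s => [|x s IH]; first by rewrite /= setadd0.
by rewrite -setaddA -IH.
Qed.

Lemma hsum1_1 (x : H) : hsum1 [:: x] = [set x].
Proof. by rewrite /hsum1 /= setaddC setadd0. Qed.

End SetAdd.

Section HBar.
Variable H : Hp_obj.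

Let hH : is_hyperring H := (hpP H).1.
Let hM : is_premultiring H := hH.1.1.
Let hG : is_hypergroup H := hypergroupP hM.

Lemma hbar_addP (S S' : hbar H) : exists s, setadd S S' = hsum1 s.
Proof.
have [[s ->] [t ->]] := (hsetP S, hsetP S').
by exists (s ++ t); rewrite hsum1_cat.
Qed.

Definition hbar_add (S S' : hbar H) : hbar H := Hbar (hbar_addP S S').

Lemma hbar_singleP (x : H) : exists s, [set x] = hsum1 s.
Proof. by exists [:: x]; rewrite hsum1_1. Qed.

Definition hbar_single (x : H) : hbar H := Hbar (hbar_singleP x).

Lemma hbar_addA : associative hbar_add.
Proof. by move=> S1 S2 S3; apply/hbar_ext/setaddA. Qed.

Lemma hbar_addC : commutative hbar_add.
Proof. by move=> S1 S2; apply/hbar_ext/setaddC. Qed.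

Lemma hbar_add0 : left_id (hbar_single (hzero H)) hbar_add.
Proof. by move=> S; apply/hbar_ext/setadd0. Qed.

End HBar.

HB.instance Definition _ (H : Hp_obj) := GRing.isNmodule.Build (hbar H)
  (@hbar_addA H) (@hbar_addC H) (@hbar_add0 H).

Section Hypersystem.
Variable H : Hp_obj.

Let hH : is_hyperring H := (hpP H).1.
Let hM : is_premultiring H := hH.1.1.
Let hG : is_hypergroup H := hypergroupP hM.

Definition hs_tang : set (hbar H) :=
  [set hbar_single x | x in [set x | x <> hzero H]].

Lemma hs_tan0P (S : hbar H) :
  tan0 hs_tang S <-> exists x : H, S = hbar_single x.
Proof.
split=> [[->|[x _ <-]]|[x ->]]; [by exists (hzero H) | by exists x |].
by have [->|nx] := pselect (x = hzero H); [left | right; exists x].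
Qed.

Definition hs_single (x : H) : tan0 hs_tang :=
  SigSub (mem_set ((hs_tan0P _).2 (ex_intro _ x erefl))).

Lemma hs_singleP (S : tan0 hs_tang) : exists x : H, S = hs_single x.
Proof.
have [x Sx] := (hs_tan0P (val S)).1 (set_mem (valP S)).
by exists x; apply: val_inj.
Qed.

Lemma setmul1l (x : H) (S : set H) : setmul [set x] S = hmul x @` S.
Proof.
apply/seteqP; split=> z; first by move=> [_ -> [y Sy <-]]; exists y.
by move=> [y Sy <-]; exists x => //; exists y.
Qed.

Lemma setmul1r (x : H) (S : set H) : setmul S [set x] = (fun y => hmul y x) @` S.
Proof.
apply/seteqP; split=> z; first by move=> [y Sy [_ -> <-]]; exists y.
by move=> [y Sy <-]; exists y => //; exists x.
Qed.

Lemma hs_lactP (a : tan0 hs_tang) (S : hbar H) :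
  exists s, setmul (hset (val a)) S = hsum1 s.
Proof.
have [x ->] := hs_singleP a; have [s ->] := hsetP S.
by exists [seq hmul x y | y <- s]; rewrite setmul1l (hH.2 x s).1.
Qed.

Lemma hs_ractP (S : hbar H) (a : tan0 hs_tang) :
  exists s, setmul S (hset (val a)) = hsum1 s.
Proof.
have [x ->] := hs_singleP a; have [s ->] := hsetP S.
by exists [seq hmul y x | y <- s]; rewrite setmul1r (hH.2 x s).2.
Qed.

Definition hs_lact (a : tan0 hs_tang) (S : hbar H) : hbar H :=
  Hbar (hs_lactP a S).

Definition hs_ract (S : hbar H) (a : tan0 hs_tang) : hbar H :=
  Hbar (hs_ractP S a).

Lemma hs_tmulP (a b : tan0 hs_tang) : tan0 hs_tang (hs_lact a (val b)).
Proof.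
have [[x ->] [y ->]] := (hs_singleP a, hs_singleP b).
apply/hs_tan0P; exists (hmul x y); apply: hbar_ext.
by rewrite /= setmul1l image_set1.
Qed.

Definition hs_tmul (a b : tan0 hs_tang) : tan0 hs_tang :=
  SigSub (mem_set (hs_tmulP a b)).

Lemma is_opp_mulN1 (e x : H) : is_opp (hone H) e -> is_opp x (hmul e x).
Proof.
move=> he; have /(_ (hzero H)) := (hH.1.2 x [:: hone H; e]).2.
rewrite /= /hsum1 /= (setaddC hG [set e]) (setadd0 hG) (setaddC hG _ [set hzero H]).
rewrite (setadd0 hG) => h; have /setaddP[a [b [-> -> ]]] : setadd [set hmul (hone H) x] [set hmul e x] (hzero H).
  apply: h; exists (hzero H); last exact: (hmul0x hM).
  by apply/setaddP; exists (hone H), e.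
by rewrite (hmul1x hM).
Qed.

Lemma hs_negP (S : hbar H) : exists s, setopp S = hsum1 s.
Proof.
have [e [he _]] := hopp_ex hG (hone H).
have [s Ss] := hs_lactP (hs_single e) S.
exists s; rewrite -Ss /= setmul1l; apply/seteqP; split=> y.
  move=> [x Sx xy]; exists x => //.
  have [z [_ uz]] := hopp_ex hG x.
  by rewrite -(uz _ xy) -(uz _ (is_opp_mulN1 x he)).
by move=> [x Sx <-]; exists x => //; exact: is_opp_mulN1.
Qed.

Definition hs_neg (S : hbar H) : hbar H := Hbar (hs_negP S).

Definition hypersystem : sysdata := {|
  scar := hbar H;
  tang := hs_tang;
  tone := hs_single (hone H);
  tmul := hs_tmul;
  lact := hs_lact;
  ract := hs_ract;
  sneg := hs_neg;
  sle := fun S S' => (S : set H) `<=` (S' : set H) |}.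

End Hypersystem.

(* Phi is defined on a hyperring H only if elementwise products of finite
   hypersums are finite hypersums, which fails in the phase hyperfield.
   It is defined on f : H -> H' only if images of finite hypersums are finite
   hypersums, which fails for the inclusion of the sign hyperfield in the real
   tropical hyperfield.  HpS is the subcategory of Hp where Phi is defined. *)
Definition mul_closed (H : Hp_obj) : Prop :=
  forall S S' : hbar H, exists s : seq H, setmul S S' = hsum1 s.

Definition image_closed (H H' : Hp_obj) (f : H -> H') : Prop :=
  forall S : hbar H, exists s : seq H', f @` (S : set H) = hsum1 s.

Record HpS_obj := HpSObj { hps :> Hp_obj; hps_mul : mul_closed hps }.

Definition nd_hypersystem (H : HpS_obj) : ndsysdata := {|
  ndsys := hypersystem H;
  ndmul := fun S S' : hypersystem H => Hbar (@hps_mul H S S') |}.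

Lemma image_closed_id (H : Hp_obj) : image_closed (@id H).
Proof. by move=> S; rewrite image_id; apply: hsetP. Qed.

Lemma image_closed_comp (H1 H2 H3 : Hp_obj) (g : H2 -> H3) (f : H1 -> H2) :
  image_closed g -> image_closed f -> image_closed (g \o f).
Proof. by move=> hg hf S; have := hg (Hbar (hf S)); rewrite /= image_comp. Qed.

Definition HpS : category :=
  @subcat Hp HpS_obj (fun H => hps H : Hp)
    (fun H H' f => image_closed (hmfun f))
    (fun H => @image_closed_id H)
    (fun H1 H2 H3 g f => @image_closed_comp H1 H2 H3 (hmfun g) (hmfun f)).

(* For f with values in a hypersystem, this says, up to singletons, that
   f b = {f a : a tangible or 0, a ⪯ b}.  A general ⪯-morphism only satisfies one inclusion: on
   finite hypersums it is not determined by its values on singletons.  For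
   instance the inclusion of the Krasner hyperfield in the triangle hyperfield
   extends to the hypersystems by {0, 1} |-> [0, c] for every 1 <= c <= 2. *)
Definition tangible_lifting (A A' : sysdata) (f : A -> A') : Prop :=
  forall (a' : T0 A') (b : A), tv a' ⪯ f b ->
    exists2 a : T0 A, tv a ⪯ b & f (tv a) = tv a'.

Lemma tangible_lifting_id (A : sysdata) : tangible_lifting (@id A).
Proof. by move=> a b ab; exists a. Qed.

Lemma tangible_lifting_comp (A B C : sysdata) (g : B -> C) (f : A -> B) :
  tangible_lifting g -> tangible_lifting f -> tangible_lifting (g \o f).
Proof.
move=> hg hf c a /hg[b ba <-]; have [x xa e] := hf _ _ ba.
by exists x => //=; rewrite e.
Qed.

Definition TBSrL : category :=
  @subcat TBSr TBSr (@id TBSr)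
    (fun A B f => tangible_lifting (smfun f))
    (fun A => @tangible_lifting_id A)
    (fun A B C g f => @tangible_lifting_comp A B C (smfun g) (smfun f)).

Definition Phi_fun (H H' : HpS) (f : mor H H') (S : hbar H) : hbar H' :=
  Hbar (proj2_sig f S).

Lemma Phi_tanP (H H' : HpS) (f : mor H H') (a : T0 (hypersystem H)) :
  tan0 (tang (hypersystem H')) (Phi_fun f (tv a)).
Proof.
have [x ->] := hs_singleP a.
by apply/hs_tan0P; exists (sval f x); apply: hbar_ext; rewrite /= image_set1.
Qed.

Definition Phi_tan (H H' : HpS) (f : mor H H') (a : T0 (hypersystem H)) :
    T0 (hypersystem H') :=
  SigSub (mem_set (Phi_tanP f a)).

Section Phi.
Hypothesis PhiO : forall H : HpS, is_TBSr (nd_hypersystem H).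
Hypothesis PhiM : forall (H H' : HpS) (f : mor H H'),
  @is_sle_mor (hypersystem H) (hypersystem H') (Phi_fun f) (Phi_tan f).
Hypothesis PhiL : forall (H H' : HpS) (f : mor H H'),
  @tangible_lifting (hypersystem H) (hypersystem H') (Phi_fun f).

Definition Phi_obj (H : HpS) : TBSrL := TBSrObj (PhiO H).

Definition Phi_mor (H H' : HpS) (f : mor H H') :
    @mor TBSrL (Phi_obj H) (Phi_obj H') :=
  exist _ (SleMor (PhiM f) : @mor TBSr (Phi_obj H) (Phi_obj H')) (@PhiL H H' f).

Program Definition Phi : functor HpS TBSrL := @Functor HpS TBSrL Phi_obj Phi_mor _ _.
Next Obligation.
by apply: subcat_ext; apply: sle_mor_ext => S; apply: hbar_ext; rewrite /= image_id.
Qed.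
Next Obligation.
by apply: subcat_ext; apply: sle_mor_ext => S; apply: hbar_ext; rewrite /= image_comp.
Qed.

End Phi.

(* Main.v *)
Require Import Defs.
From mathcomp Require Import all_boot all_algebra.
From mathcomp Require Import boolp classical_sets.

Set Implicit Arguments.
Unset Strict Implicit.
Unset Printing Implicit Defensive.

Import GRing.Theory.
Local Open Scope classical_set_scope.
Local Open Scope ring_scope.

(** Everything rests on one interpolation property.  Since a summand can be
    moved across ∇ at the price of a sign, [c ∇ b + b'] means [c - b' ∇ b].
    Tangible balancing then inserts a tangible [a] with [a ∇ b] and
    [c - b' ∇ a], and tangible balance elimination removes it again
    ([nabla_interpolation]).  So in a sum on the right of ∇ any term may be
    traded for the tangible elements that balance it.  By induction the iterated
    hypersum of tangible elements is the set of tangible elements balancing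
    their sum in the system ([hsum_boxnabla], [hsum1_nabla]).  Associativity of
    the hyperaddition becomes associativity of [+], reversibility and the unique
    opposites come from moving terms across ∇, and multiplication by a tangible
    element preserves ∇, which gives a multiring.  ∇-inversion divides a
    balance by a tangible element, which is exactly the missing inclusion for a
    hyperring.

    In the hypersystem of a hyperring two sets balance iff they meet
    ([hs_nablaE]).  Tangible balancing, balance elimination and ∇-inversion are
    then plain set theory, and the tangible elements balancing [S] are the
    singletons of the members of [S].  Hence the hyperring of balances of the
    hypersystem is the original one.

    A ⪯-morphism only satisfies [f (b + b') ⪯ f b + f b'], but it commutes with
    negation on tangible elements, because [f (-1)] is tangible and balances
    [-1].  Therefore it preserves balances with tangible elements, and its
    restriction to them is a morphism of hyperrings.

    Hyper-type makes [a ∇ b] and [a ⪯ b] equivalent for tangible [a], and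
    identifies the tangible elements balancing a product [b b'] with the
    products of those balancing [b] and [b'] ([hyper_nabla_mul]).  It follows
    that hypersums of the hyperring of balances are closed under elementwise
    multiplication, and that the map [b |-> {a | a ∇ b}] to the hypersystem of
    that hyperring has the lifting property; by interpolation and ∇-inversion it
    is a ⪯-morphism, and it is the reflection.  A morphism [f] to a
    hypersystem with the lifting property is determined by its restriction [h]
    to tangible elements, because then [f b = h {a | a ∇ b}]
    ([lifting_hs_restr]); this gives the universal property, and, applied to a
    hypersystem as the source, fullness. *)

(** * Bimodules generated by tangible elements *)

Section BimoduleTheory.
Variables (A : sysdata) (bimA : is_Tgen_bimodule A).

Lemma tv_inj : injective (@tv A).
Proof. exact: val_inj. Qed.

Lemma tzeroVtang (a : T0 A) : a = tzero A \/ tang A (tv a).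
Proof.
by case: (set_mem (valP a)) => [a0|]; [left; apply: tv_inj | right].
Qed.

Lemma lact_big (I : Type) (a : T0 A) (s : seq I) (F : I -> A) :
  a *l (\sum_(i <- s) F i) = \sum_(i <- s) a *l F i.
Proof. by have := lact_sum bimA a (map F s); rewrite !big_map. Qed.

Lemma ract_big (I : Type) (a : T0 A) (s : seq I) (F : I -> A) :
  (\sum_(i <- s) F i) *r a = \sum_(i <- s) F i *r a.
Proof. by have := ract_sum bimA a (map F s); rewrite !big_map. Qed.

Lemma lactD (a : T0 A) (b b' : A) : a *l (b + b') = a *l b + a *l b'.
Proof. by have := lact_sum bimA a [:: b; b']; rewrite !big_cons !big_nil !addr0. Qed.

Lemma ractD (a : T0 A) (b b' : A) : (b + b') *r a = b *r a + b' *r a.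
Proof. by have := ract_sum bimA a [:: b; b']; rewrite !big_cons !big_nil !addr0. Qed.

Lemma tv_tmul_lact (a b : T0 A) : tv (tmul a b) = a *l tv b.
Proof. by rewrite -(lactx1 bimA (tmul a b)) (lactA bimA) (lactx1 bimA). Qed.

Lemma tv_tmul_ract (a b : T0 A) : tv (tmul a b) = tv a *r b.
Proof. by rewrite -(ract1x bimA (tmul a b)) (ractA bimA) (ract1x bimA). Qed.

Lemma tmul0x (a : T0 A) : tmul (tzero A) a = tzero A.
Proof. by apply: tv_inj; rewrite tv_tmul_lact (lact0x bimA). Qed.

Lemma tmulx0 (a : T0 A) : tmul a (tzero A) = tzero A.
Proof. by apply: tv_inj; rewrite tv_tmul_lact (lactx0 bimA). Qed.

Lemma tone_neq0 : tone A <> tzero A.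
Proof. by move=> e; apply: (tang_n0 bimA); move: (tang_1 bimA); rewrite e. Qed.

End BimoduleTheory.

(** * Balances in a system and the hyperaddition of tangible elements *)

Section SystemTheory.
Variables (A : sysdata) (hA : is_system A).

Let bimA : is_Tgen_bimodule A. Proof. by case: hA => -[]. Qed.
Let negA : is_negation_map A. Proof. by case: hA => -[]. Qed.
Let surA : is_surpassing A. Proof. by case: hA. Qed.

(** Negation is the action of the tangible element -1, so that all
    compatibilities with the action pass to negation. *)
Lemma negone_ex : exists2 e : T0 A, tang A (tv e) &
  tv e = sneg (tv (tone A)) /\ forall b : A, e *l b = sneg b /\ b *r e = sneg b.
Proof.
have [e ee eP] := sneg_tan negA (tang_1 bimA).
exists e; first by rewrite ee; apply: (sneg_one negA).
split=> // b; have [-> ->] := eP b.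
by rewrite (lact1x bimA) (ractx1 bimA).
Qed.

Lemma sneg_tangible (a : T0 A) : exists a' : T0 A, tv a' = sneg (tv a).
Proof.
have [e _ [_ eP]] := negone_ex; exists (tmul e a).
by rewrite (tv_tmul_lact bimA) (eP _).1.
Qed.

Lemma lactN (a : T0 A) (b : A) : a *l sneg b = sneg (a *l b).
Proof.
have [->|ta] := tzeroVtang a; last exact: (sneg_lact negA).
by rewrite !(lact0x bimA) (sneg0 negA).
Qed.

Lemma ractN (a : T0 A) (b : A) : sneg b *r a = sneg (b *r a).
Proof.
have [->|ta] := tzeroVtang a; last exact: (sneg_ract negA).
by rewrite !(ractx0 bimA) (sneg0 negA).
Qed.

Lemma sleD (b1 b2 b1' b2' : A) : b1 ⪯ b1' -> b2 ⪯ b2' -> b1 + b2 ⪯ b1' + b2'.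
Proof.
move=> h1 h2; have := sle_lact surA (tang_1 bimA) (tang_1 bimA) h1 h2.
by rewrite !(lact1x bimA).
Qed.

Lemma lact_sle (a : T0 A) (b b' : A) : b ⪯ b' -> a *l b ⪯ a *l b'.
Proof.
move=> h; have [->|ta] := tzeroVtang a.
  by rewrite !(lact0x bimA); apply: (sle_refl surA).
have := sle_lact surA ta (tang_1 bimA) h (sle_refl surA 0).
by rewrite (lactx0 bimA) !addr0.
Qed.

Lemma ract_sle (a : T0 A) (b b' : A) : b ⪯ b' -> b *r a ⪯ b' *r a.
Proof.
move=> h; have [->|ta] := tzeroVtang a.
  by rewrite !(ractx0 bimA); apply: (sle_refl surA).
have := sle_ract surA ta (tang_1 bimA) h (sle_refl surA 0).
by rewrite (ract0x bimA) !addr0.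
Qed.

Lemma sneg_sle (b b' : A) : b ⪯ b' -> sneg b ⪯ sneg b'.
Proof.
have [e _ [_ eP]] := negone_ex => /(lact_sle e).
by rewrite (eP b).1 (eP b').1.
Qed.

Lemma nablaxx (b : A) : b ∇ b.
Proof. exact: (sle_0circ surA). Qed.

Lemma nabla_sym (b b' : A) : b ∇ b' -> b' ∇ b.
Proof.
rewrite /nabla /Null /= => /sneg_sle.
by rewrite (sneg0 negA) (snegD negA) (snegK negA) addrC.
Qed.

(** The transposition rule that makes ∇ behave like an equation between
    differences. *)
Lemma nabla_addr (b c b' : A) : (b + c ∇ b') = (b ∇ b' + sneg c).
Proof.
by rewrite /nabla (snegD negA) (snegK negA) -addrA [c + _]addrC.
Qed.

Lemma nabla_tangible (a a' : T0 A) : tv a ∇ tv a' -> a = a'.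
Proof.
have tangible0 (c : T0 A) : tv c ∇ 0 -> c = tzero A.
  rewrite /nabla (sneg0 negA) addr0 => c0.
  by rewrite -(sle_tan surA (a := tzero A) (a' := c)).
have [->|ta] := tzeroVtang a; first by move/nabla_sym/tangible0.
have [->|ta'] := tzeroVtang a'; first by move/tangible0.
by case: hA => _ _; apply.
Qed.

Lemma nabla_sle (b c d : A) : b ∇ c -> c ⪯ d -> b ∇ d.
Proof.
move=> bc cd; apply: (sle_trans surA bc).
by apply: sleD; [apply: (sle_refl surA) | apply: sneg_sle].
Qed.

Lemma sle_nabla (b c : A) : b ⪯ c -> b ∇ c.
Proof. exact/nabla_sle/nablaxx. Qed.

Lemma nabla_lact (a : T0 A) (b b' : A) : b ∇ b' -> a *l b ∇ a *l b'.
Proof. by move/(lact_sle a); rewrite (lactx0 bimA) (lactD bimA) lactN. Qed.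

Lemma nabla_ract (a : T0 A) (b b' : A) : b ∇ b' -> b *r a ∇ b' *r a.
Proof. by move/(ract_sle a); rewrite (ract0x bimA) (ractD bimA) ractN. Qed.

Lemma boxnablaE (S : seq (set (T0 A))) (a : T0 A) :
  boxnabla S a <-> nabla_set (tv a) (sumset [seq @tv A @` Si | Si <- S]).
Proof. by []. Qed.

Lemma hadd_nabla (a b : T0 A) :
  @hadd (nabla_hyper A) a b = [set c : T0 A | tv c ∇ tv a + tv b].
Proof.
apply/seteqP; split=> c /=.
  by case=> [_ [_ [_ -> <-]] [_ [_ [_ -> <-]] [_ -> <-]] <-]; rewrite addr0.
move=> h; exists (tv a + (tv b + 0)); last by rewrite addr0.
exists (tv a); [by exists a | exists (tv b + 0) => //].
by exists (tv b); [exists b | exists 0].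
Qed.

Hypothesis balA : tangibly_balanced A.
Hypothesis elimA : tangible_balance_elimination A.

(** Read [c ∇ b + b'] as [c - b' ∇ b]: tangible balancing inserts a tangible
    element between the two sides, and tangible balance elimination removes
    it. *)
Lemma nabla_interpolation (c b b' : A) :
  c ∇ b + b' <-> exists2 a : T0 A, tv a ∇ b & c ∇ tv a + b'.
Proof.
have move_b' d : (c ∇ d + b') = (c + sneg b' ∇ d).
  by rewrite nabla_addr (snegK negA).
rewrite move_b'; split=> [/balA[a [ca ba]]|[a ab]].
  by exists a; [apply: nabla_sym | rewrite move_b'].
by rewrite move_b' => /elimA; apply.
Qed.

Lemma tangible_nabla (b : A) : exists a : T0 A, tv a ∇ b.
Proof. by have [a [/nabla_sym]] := balA (nablaxx b); exists a. Qed.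

(** Each step of the iterated hypersum trades the sum of the remaining terms
    for a tangible element balancing it, which loses nothing by
    interpolation. *)
Lemma hsum_boxnabla (S : seq (set (nabla_hyper A))) : hsum S = boxnabla S.
Proof.
elim: S => [|S1 S IH]; apply/seteqP; split=> z.
- by move->; exists 0 => //; apply: nablaxx.
- by move=> [_ -> z0]; apply: (nabla_tangible (a' := tzero A)).
- rewrite [hsum _]/= IH => -[x S1x [y [b Sb yb]]]; rewrite hadd_nabla => zxy.
  exists (tv x + b); first by exists (tv x); [exists x | exists b].
  by rewrite addrC; apply/nabla_interpolation; exists y; rewrite // addrC.
move=> [_ [_ [x S1x <-] [b Sb <-]]].
rewrite addrC => /nabla_interpolation[y yb zyx].
exists x => //; exists y; first by rewrite /= IH; exists b.
by rewrite hadd_nabla /= addrC.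
Qed.

Lemma sumset1 (s : seq (T0 A)) :
  sumset [seq @tv A @` Si | Si <- [seq [set x] | x <- s]] =
  [set \sum_(x <- s) tv x].
Proof.
elim: s => [|x s IH]; first by rewrite big_nil.
rewrite big_cons [LHS]/= IH; apply/seteqP; split=> z.
  by case=> [_ [_ -> <-] [_ -> <-]].
by move->; exists (tv x); [exists x | exists (\sum_(y <- s) tv y)].
Qed.

Lemma hsum1_nabla (s : seq (nabla_hyper A)) :
  hsum1 s = [set a : T0 A | tv a ∇ \sum_(x <- s) tv x].
Proof.
rewrite /hsum1 hsum_boxnabla; apply/seteqP; split=> a /=.
  by rewrite boxnablaE sumset1 => -[_ ->].
by move=> h; rewrite boxnablaE sumset1; exists (\sum_(x <- s) tv x).
Qed.

Lemma is_opp_nabla (a b : T0 A) :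
  @is_opp (nabla_hyper A) a b <-> tv b = sneg (tv a).
Proof.
have [c ca] := sneg_tangible a.
rewrite /is_opp hadd_nabla -ca /= addrC.
have -> : (0 ∇ tv b + tv a) = (tv c ∇ tv b).
  by rewrite -[tv c]add0r nabla_addr ca (snegK negA).
by split=> [/nabla_tangible -> //| ->]; apply: nablaxx.
Qed.

(** Both bracketings of a triple hypersum are the balances of the same sum of
    three terms.  Opposites are unique because distinct tangible elements do not
    balance. *)
Lemma nabla_hypergroup : is_hypergroup (nabla_hyper A).
Proof.
split.
- move=> a b; rewrite hadd_nabla; have [c ?] := tangible_nabla (tv a + tv b).
  by exists c.
- by move=> a b; rewrite !hadd_nabla [tv a + _]addrC.
- move=> a b c.
  suff assoc_l (x y z : nabla_hyper A) : setadd [set x] (@hadd (nabla_hyper A) y z) =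
      [set d : nabla_hyper A | tv d ∇ tv x + (tv y + tv z)].
    have -> : setadd (@hadd (nabla_hyper A) a b) [set c] =
        setadd [set c] (@hadd (nabla_hyper A) a b).
      apply/seteqP; split=> z /setaddP[x [y [h1 h2]]]; rewrite hadd_nabla /= => h3;
        by apply/setaddP; exists y, x; rewrite hadd_nabla /= addrC.
    by rewrite !assoc_l [tv c + _]addrC addrA.
  apply/seteqP; split=> d.
    move=> /setaddP[_ [u [-> ]]]; rewrite !hadd_nabla /= => uyz dxu.
    by rewrite addrC; apply/nabla_interpolation; exists u; rewrite // addrC.
  move=> dxyz; have : tv d ∇ (tv y + tv z) + tv x by rewrite addrC.
  case/nabla_interpolation=> u uyz dux.
  by apply/setaddP; exists x, u; split=> //; rewrite hadd_nabla //= addrC.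
- move=> a; rewrite hadd_nabla /= add0r; apply/seteqP; split=> b /=.
    exact: nabla_tangible.
  by move->; apply: nablaxx.
- move=> a; have [c ca] := sneg_tangible a; exists c.
  split=> [|b]; rewrite is_opp_nabla // => ba.
  by apply: tv_inj; rewrite ca.
- move=> a1 a2 a3 a2' /is_opp_nabla e2; rewrite !hadd_nabla /= e2.
  have -> : (tv a1 ∇ tv a2 + tv a3) = (tv a1 + sneg (tv a2) ∇ tv a3).
    by rewrite nabla_addr (snegK negA) addrC.
  by split; apply: nabla_sym.
Qed.

Lemma nabla_multiring : is_multiring (nabla_hyper A).
Proof.
split.
  split; [exact: nabla_hypergroup | exact: (tmulA bimA) | exact: (tmul1x bimA)
    | exact: (tmulx1 bimA) | exact: (tmul0x bimA) | exact: (tmulx0 bimA)].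
move=> a s; rewrite !hsum1_nabla; split=> _ [c /= cs <-]; rewrite big_map.
  rewrite (tv_tmul_lact bimA) (eq_bigr (fun x => a *l tv x)) => [|x _]; last first.
    exact: (tv_tmul_lact bimA).
  by rewrite -(lact_big bimA); apply: nabla_lact.
rewrite (tv_tmul_ract bimA) (eq_bigr (fun x => tv x *r a)) => [|x _]; last first.
  exact: (tv_tmul_ract bimA).
by rewrite -(ract_big bimA); apply: nabla_ract.
Qed.

(** If [c] balances [a \sum s], then inversion yields a quotient [d] with
    [a d = c] that still balances [\sum s]; this is the inclusion that a
    multiring lacks. *)
Lemma nabla_hyperring : nabla_inversion A -> is_hyperring (nabla_hyper A).
Proof.
move=> [invl invr]; split; first exact: nabla_multiring.
move=> a s; have [subl subr] := nabla_multiring.2 a s.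
split; apply/seteqP; split=> // c; rewrite !hsum1_nabla /= big_map.
  rewrite (eq_bigr (fun x => a *l tv x)) => [|x _]; last exact: (tv_tmul_lact bimA).
  rewrite -(lact_big bimA) => /nabla_sym /invl[d [<- sd]].
  by exists d => //; apply: nabla_sym.
rewrite (eq_bigr (fun x => tv x *r a)) => [|x _]; last exact: (tv_tmul_ract bimA).
rewrite -(ract_big bimA) => /nabla_sym /invr[d [<- sd]].
by exists d => //; apply: nabla_sym.
Qed.

End SystemTheory.

(** * The hypersystem of a hyperring *)

Section HypersystemTheory.
Variable H : Hp_obj.

Let hH : is_hyperring H := (hpP H).1.
Let hM : is_premultiring H := hH.1.1.
Let hG : is_hypergroup H := hypergroupP hM.

Lemma is_opp_sym (x y : H) : is_opp x y -> is_opp y x.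
Proof. by rewrite /is_opp (haddC hG). Qed.

Lemma is_opp_inj (x x' y : H) : is_opp x y -> is_opp x' y -> x = x'.
Proof.
have [z [_ uz]] := hopp_ex hG y.
by move=> /is_opp_sym/uz <- /is_opp_sym/uz <-.
Qed.

Lemma hbar_neq0 (S : hbar H) : hset S !=set0.
Proof.
have [s ->] := hsetP S; elim: s => [|x s [y ys]]; first by exists (hzero H).
have [z xyz] := hadd_ne hG x y; exists z.
by apply/setaddP; exists x, y.
Qed.

(** The mirror image of [is_opp_mulN1]; together they show that the opposite of
    1 is central, as the negation map of the hypersystem requires on both
    sides. *)
Lemma is_opp_mulxN1 (e x : H) : is_opp (hone H) e -> is_opp x (hmul x e).
Proof.
move=> he; have := (hH.1.2 x [:: hone H; e]).1 (hzero H).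
rewrite [map _ _]/= !(hsum1_cat hG [:: _] [:: _]) !(hsum1_1 hG).
case/(_ _)/setaddP=> [|y [z [-> ->]]]; last by rewrite (hmulx1 hM).
exists (hzero H); last exact: (hmulx0 hM).
by apply/setaddP; exists (hone H), e.
Qed.

Lemma hmulN1C (e x : H) : is_opp (hone H) e -> hmul e x = hmul x e.
Proof.
move=> he; apply: (is_opp_inj (y := x)); apply: is_opp_sym.
  exact: is_opp_mulN1.
exact: is_opp_mulxN1.
Qed.

Lemma setopp_mulN1 (e : H) (S : set H) :
  is_opp (hone H) e -> setopp S = hmul e @` S.
Proof.
move=> he; apply/seteqP; split=> y.
  move=> [x Sx xy]; exists x => //.
  by apply: (is_opp_inj (y := x)); apply: is_opp_sym; first exact: is_opp_mulN1.
by move=> [x Sx <-]; exists x => //; exact: is_opp_mulN1.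
Qed.

(** Distributivity of a hyperring is assumed for hypersums of elements; it
    extends to sums of sets that are themselves such hypersums. *)
Lemma hmul_setadd (x : H) (S S' : hbar H) :
  hmul x @` setadd S S' = setadd (hmul x @` S) (hmul x @` S').
Proof.
have [[s ->] [t ->]] := (hsetP S, hsetP S').
by rewrite -(hsum1_cat hG) !(hH.2 x _).1 map_cat (hsum1_cat hG).
Qed.

Lemma hmulr_setadd (x : H) (S S' : hbar H) :
  (fun y => hmul y x) @` setadd S S' =
  setadd ((fun y => hmul y x) @` S) ((fun y => hmul y x) @` S').
Proof.
have [[s ->] [t ->]] := (hsetP S, hsetP S').
by rewrite -(hsum1_cat hG) !(hH.2 x _).2 map_cat (hsum1_cat hG).
Qed.

Lemma hbar_single_inj : injective (@hbar_single H).
Proof.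
move=> x y /(congr1 (@hset H)) /= e.
by have : [set x] x by []; rewrite e.
Qed.

Lemma hs_single_inj : injective (@hs_single H).
Proof. by move=> x y /(congr1 val)/hbar_single_inj. Qed.

Lemma hs_lactE (x : H) (S : hypersystem H) :
  hset (@lact (hypersystem H) (hs_single x) S) = hmul x @` hset S.
Proof. exact: setmul1l. Qed.

Lemma hs_ractE (x : H) (S : hypersystem H) :
  hset (@ract (hypersystem H) S (hs_single x)) = (fun y => hmul y x) @` hset S.
Proof. exact: setmul1r. Qed.

Lemma hs_tmulE (x y : H) :
  @tmul (hypersystem H) (hs_single x) (hs_single y) = hs_single (hmul x y).
Proof.
by apply: val_inj; apply: hbar_ext; rewrite [LHS]hs_lactE image_set1.
Qed.

Lemma hbar_sumE (s : seq H) : hset (\sum_(x <- s) hbar_single x) = hsum1 s.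
Proof.
elim: s => [|x s IH]; first by rewrite big_nil.
by rewrite big_cons -[hsum1 _]/(setadd [set x] (hsum1 s)) -IH.
Qed.

Lemma hypersystem_Tgen : is_Tgen_bimodule (hypersystem H).
Proof.
have lact0 (a : T0 (hypersystem H)) : a *l 0 = 0.
  have [x ->] := hs_singleP a.
  by apply: hbar_ext; rewrite hs_lactE image_set1 (hmulx0 hM).
have ract0 (a : T0 (hypersystem H)) : (0 : hypersystem H) *r a = 0.
  have [x ->] := hs_singleP a.
  by apply: hbar_ext; rewrite hs_ractE image_set1 (hmul0x hM).
have zeroE : tzero (hypersystem H) = hs_single (hzero H) by apply: val_inj.
have nonempty_set1 (S : hypersystem H) (c : H) : (fun=> c) @` hset S = [set c].
  apply/seteqP; split=> y; first by case=> _ _ <-.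
  by move->; have [z Sz] := hbar_neq0 S; exists z.
split.
- by move=> [x nx] /hbar_single_inj.
- by exists (hone H) => //; apply: (hpP H).2.
- move=> a b c; have [[x ->] [y ->]] := (hs_singleP a, hs_singleP b).
  have [z ->] := hs_singleP c.
  by rewrite !hs_tmulE (hmulA hM).
- by move=> a; have [x ->] := hs_singleP a; rewrite hs_tmulE (hmul1x hM).
- by move=> a; have [x ->] := hs_singleP a; rewrite hs_tmulE (hmulx1 hM).
- move=> S; have [s Ss] := hsetP S; exists (map (@hs_single H) s).
  by apply: hbar_ext; rewrite big_map hbar_sumE.
- move=> a b S; have [[x ->] [y ->]] := (hs_singleP a, hs_singleP b).
  apply: hbar_ext; rewrite hs_tmulE !hs_lactE image_comp.
  by apply: eq_imagel => z _ /=; rewrite (hmulA hM).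
- move=> S; rewrite zeroE; apply: hbar_ext; rewrite hs_lactE.
  rewrite -[RHS](nonempty_set1 S); apply: eq_imagel => z _.
  exact: (hmul0x hM).
- move=> S; apply: hbar_ext; rewrite hs_lactE -[RHS]image_id.
  by apply: eq_imagel => z _; rewrite (hmul1x hM).
- move=> a; have [x ->] := hs_singleP a.
  by apply: hbar_ext; rewrite hs_lactE image_set1 (hmulx1 hM).
- exact: lact0.
- move=> a s; elim: s => [|S s IH]; first by rewrite !big_nil.
  rewrite !big_cons -IH; have [x ->] := hs_singleP a.
  by apply: hbar_ext; rewrite hs_lactE hmul_setadd -!hs_lactE.
- move=> a b S; have [[x ->] [y ->]] := (hs_singleP a, hs_singleP b).
  apply: hbar_ext; rewrite hs_tmulE !hs_ractE image_comp.
  by apply: eq_imagel => z _ /=; rewrite (hmulA hM).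
- move=> S; rewrite zeroE; apply: hbar_ext; rewrite hs_ractE.
  rewrite -[RHS](nonempty_set1 S); apply: eq_imagel => z _.
  exact: (hmulx0 hM).
- move=> S; apply: hbar_ext; rewrite hs_ractE -[RHS]image_id.
  by apply: eq_imagel => z _; rewrite (hmulx1 hM).
- move=> a; have [x ->] := hs_singleP a.
  by apply: hbar_ext; rewrite hs_ractE image_set1 (hmul1x hM).
- exact: ract0.
- move=> a s; elim: s => [|S s IH]; first by rewrite !big_nil.
  rewrite !big_cons -IH; have [x ->] := hs_singleP a.
  by apply: hbar_ext; rewrite hs_ractE hmulr_setadd -!hs_ractE.
Qed.

Lemma hs_neg_mulN1 (e : H) (S : hypersystem H) :
  is_opp (hone H) e -> hs_neg S = hs_lact (hs_single e) S.
Proof. by move=> he; apply: hbar_ext; rewrite hs_lactE [LHS](setopp_mulN1 _ he). Qed.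

Lemma hypersystem_neg : is_negation_map (hypersystem H).
Proof.
have bim := hypersystem_Tgen.
have [e [he _]] := hopp_ex hG (hone H).
have ee : hmul e e = hone H.
  exact: is_opp_inj (is_opp_sym (is_opp_mulN1 e he)) he.
have negE S : @sneg (hypersystem H) S = (hs_single e : T0 (hypersystem H)) *l S.
  exact: hs_neg_mulN1.
have negEr S : @sneg (hypersystem H) S = S *r (hs_single e : T0 (hypersystem H)).
  rewrite negE; apply: hbar_ext; rewrite hs_lactE hs_ractE.
  by apply: eq_imagel => z _; apply: hmulN1C.
pose e1 : T0 (hypersystem H) := hs_single e.
have eC (a : T0 (hypersystem H)) : tmul a e1 = tmul e1 a.
  by have [x ->] := hs_singleP a; rewrite !hs_tmulE (hmulN1C _ he).
have e_n0 : e <> hzero H.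
  by move=> e0; apply: (hpP H).2; rewrite -ee e0 (hmul0x hM).
split.
- by rewrite negE (lactx0 bim).
- by move=> S S'; rewrite !negE (lactD bim).
- by move=> S; rewrite !negE -(lactA bim) hs_tmulE ee -[RHS](lact1x bim).
- exists e => //; apply: hbar_ext.
  by rewrite negE (lactx1 bim).
- move=> a _; exists (tmul e1 a); first by rewrite negE (tv_tmul_lact bim).
  move=> S; split; first by rewrite (lactA bim) negE.
  by rewrite -eC (ractA bim) negEr.
- by move=> a S _; rewrite !negE -!(lactA bim) eC.
- by move=> a S _; rewrite !negEr -!(ractA bim) eC.
Qed.

Lemma hs_sleE (S S' : hypersystem H) : (S ⪯ S') = (hset S `<=` hset S').
Proof. by []. Qed.

Lemma hs_nullE (S : hypersystem H) : Null S <-> hset S (hzero H).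
Proof. by rewrite /Null mksetE hs_sleE; split=> [|S0]; [apply | move=> _ ->]. Qed.

(** [0] lies in [S - S'] iff some element of [S] is opposite to the opposite of
    some element of [S'], and opposites are unique. *)
Lemma hs_nablaE (S S' : hypersystem H) : S ∇ S' <-> exists x, hset S x /\ hset S' x.
Proof.
rewrite /nabla hs_nullE; split.
  move=> /setaddP[x [y [Sx [z S'z zy] xy]]]; exists x; split=> //.
  by rewrite (is_opp_inj xy zy).
move=> [x [Sx S'x]]; apply/setaddP.
have [y [xy _]] := hopp_ex hG x.
by exists x, y; split=> //; exists x.
Qed.

Lemma hs_nabla_single (x : H) (S : hypersystem H) :
  (tv (hs_single x : T0 (hypersystem H)) ∇ S) <-> hset S x.
Proof.
rewrite hs_nablaE; split=> [[y [-> ]] //|Sx].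
by exists x.
Qed.

Lemma hs_sle_single (x : H) (S : hypersystem H) :
  (tv (hs_single x : T0 (hypersystem H)) ⪯ S) <-> hset S x.
Proof. by rewrite hs_sleE; split=> [|Sx]; [apply | move=> _ ->]. Qed.

Lemma setadd_subset (S1 S2 S1' S2' : set H) :
  S1 `<=` S1' -> S2 `<=` S2' -> setadd S1 S2 `<=` setadd S1' S2'.
Proof.
move=> h1 h2 z /setaddP[x [y [Sx Sy h]]].
by apply/setaddP; exists x, y; split=> //; [apply: h1 | apply: h2].
Qed.

Lemma hypersystem_sur : is_surpassing (hypersystem H).
Proof.
split.
- by move=> S; rewrite hs_sleE.
- by move=> S1 S2 S3; rewrite !hs_sleE => h1 h2 x /h1 /h2.
- move=> S; rewrite hs_sleE => S0; apply: hbar_ext; apply/seteqP; split=> // _ ->.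
  by have [x Sx] := hbar_neq0 S; rewrite -(S0 _ Sx).
- move=> S; have [x Sx] := hbar_neq0 S.
  by have /hs_nablaE : exists x, hset S x /\ hset S x by exists x.
- move=> a1 a2 S1 S2 S1' S2' _ _; rewrite !hs_sleE => h1 h2.
  have [[x ->] [y ->]] := (hs_singleP a1, hs_singleP a2).
  by apply: setadd_subset; rewrite !hs_lactE; apply: image_subset.
- move=> a1 a2 S1 S2 S1' S2' _ _; rewrite !hs_sleE => h1 h2.
  have [[x ->] [y ->]] := (hs_singleP a1, hs_singleP a2).
  by apply: setadd_subset; rewrite !hs_ractE; apply: image_subset.
- move=> a a'; have [[x ->] [y ->]] := (hs_singleP a, hs_singleP a').
  by move=> /hs_sle_single ->.
Qed.

Lemma hypersystem_system : is_system (hypersystem H).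
Proof.
split; [split|exact: hypersystem_sur|].
- exact: hypersystem_Tgen.
- exact: hypersystem_neg.
- move=> S [x nx e]; have := sle_0circ hypersystem_sur S.
  by rewrite -e => /hs_nullE/esym.
move=> a a' _ _; have [[x ->] [y ->]] := (hs_singleP a, hs_singleP a').
by move=> /hs_nabla_single ->.
Qed.

Lemma hypersystem_balanced : tangibly_balanced (hypersystem H).
Proof.
move=> S S' /hs_nablaE[x [Sx S'x]]; exists (hs_single x).
by split; apply: (nabla_sym hypersystem_system); apply/hs_nabla_single.
Qed.

Lemma hypersystem_elimination : tangible_balance_elimination (hypersystem H).
Proof.
move=> a S S'; have [x ->] := hs_singleP a.
move=> /(nabla_sym hypersystem_system) /hs_nabla_single Sx /hs_nabla_single S'x.
by apply/hs_nablaE; exists x.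
Qed.

Lemma hypersystem_inversion : nabla_inversion (hypersystem H).
Proof.
split=> a a1 S; have [[x ->] [y ->]] := (hs_singleP a, hs_singleP a1);
  move=> /(nabla_sym hypersystem_system) /hs_nabla_single.
  rewrite hs_lactE => -[z Sz <-]; exists (hs_single z); split; first exact: hs_tmulE.
  by apply: (nabla_sym hypersystem_system); apply/hs_nabla_single.
rewrite hs_ractE => -[z Sz <-]; exists (hs_single z); split; first exact: hs_tmulE.
by apply: (nabla_sym hypersystem_system); apply/hs_nabla_single.
Qed.

(** The inverse of [hs_single]: the element of a tangible singleton. *)
Definition hs_val (a : T0 (hypersystem H)) : H := sval (cid (hs_singleP a)).

Lemma hs_valK : cancel hs_val (@hs_single H).
Proof. by move=> a; rewrite /hs_val; case: cid => x /= ->. Qed.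

Lemma hs_singleK : cancel (@hs_single H) hs_val.
Proof. by move=> x; apply: hs_single_inj; rewrite hs_valK. Qed.

Lemma hs_single_iso : @is_hyp_iso H (nabla_hyper (hypersystem H)) (@hs_single H).
Proof.
split.
- by exists hs_val; [apply: hs_singleK | apply: hs_valK].
- exact: val_inj.
- by [].
- by move=> x y; rewrite -hs_tmulE.
move=> x y; rewrite hadd_nabla; apply/seteqP; split=> a.
  move=> [z xyz <-]; apply/hs_nabla_single.
  by apply/setaddP; exists x, y.
have [z ->] := hs_singleP a => /hs_nabla_single /setaddP[_ [_ [-> -> h]]].
by exists z.
Qed.

End HypersystemTheory.

(** * Restriction of a morphism to tangible elements *)

Section MorphismRestriction.
Variables (A B : sysdata) (hA : is_system A) (hB : is_system B).
Variable f : sle_mor A B.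

Let fP : is_sle_mor f (smtan f) := smP f.

Lemma smtan0 : smtan f (tzero A) = tzero B.
Proof. by apply: tv_inj; rewrite -(sm_restr fP) (sm_0 fP). Qed.

(** Morphisms are not additive, so this needs an argument: from [0 ⪯ 1 - 1] one
    gets [0 ⪯ 1 + f (-1)], and tangible elements that balance are equal. *)
Lemma sle_mor_neg (a : T0 A) : f (sneg (tv a)) = sneg (tv (smtan f a)).
Proof.
have [[bimA _ _] _ _] := hA; have [[bimB negB _] surB _] := hB.
have [e _ [e1 eP]] := negone_ex hA.
have fe1 : tv (smtan f e) = sneg (tv (tone B)).
  have := sm_mono fP (nablaxx hA (tv (tone A))).
  rewrite (sm_0 fP) -e1 => /(sle_trans surB) /(_ (sm_add fP _ _)).
  rewrite !(sm_restr fP) (sm_1 fP) => le0.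
  have [e' e'1] := sneg_tangible hB (tone B).
  rewrite -e'1; congr tv; apply: (nabla_tangible hB).
  by rewrite e'1 /nabla (snegK negB) addrC.
rewrite -(eP _).1 (sm_lact fP) (sm_restr fP).
have [e' _ [e'1 e'P]] := negone_ex hB.
by rewrite -(e'P _).1; congr (_ *l _); apply: tv_inj; rewrite fe1.
Qed.

Lemma sle_mor_sum (s : seq (T0 A)) :
  f (\sum_(x <- s) tv x) ⪯ \sum_(x <- s) tv (smtan f x).
Proof.
have [_ surB _] := hB.
elim: s => [|x s IH].
  by rewrite !big_nil (sm_0 fP); apply: (sle_refl surB).
rewrite !big_cons -(sm_restr fP); apply: (sle_trans surB (sm_add fP _ _)).
by apply: (sleD hB) => //; apply: (sle_refl surB).
Qed.

(** From [0 ⪯ b - a] follows [0 ⪯ f (b - a) ⪯ f b + f (-a) = f b - f a]. *)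
Lemma sle_mor_nabla (a : T0 A) (b : A) : tv a ∇ b -> tv (smtan f a) ∇ f b.
Proof.
have [_ surB _] := hB => /(nabla_sym hA) /(sm_mono fP).
rewrite (sm_0 fP) => /(sle_trans surB) /(_ (sm_add fP _ _)).
by rewrite sle_mor_neg => /(nabla_sym hB).
Qed.

Hypotheses (balA : tangibly_balanced A) (elimA : tangible_balance_elimination A).
Hypotheses (balB : tangibly_balanced B) (elimB : tangible_balance_elimination B).

Lemma smtan_hyp_mor : @is_hyp_mor (nabla_hyper A) (nabla_hyper B) (smtan f).
Proof.
split; [exact: smtan0 | exact: (sm_1 fP) | exact: (sm_tmul fP) | move=> s].
rewrite (hsum1_nabla hA balA elimA) (hsum1_nabla hB balB elimB) big_map.
move=> _ [a /= /sle_mor_nabla as_ <-].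
exact (nabla_sle hB as_ (sle_mor_sum s)).
Qed.

End MorphismRestriction.

(** * Systems of hyper-type *)

Section HyperType.
Variable A : ndsysdata.
Hypotheses (ndA : is_nd_semiring_system A) (hypA : hyper_type A).

Let hA : is_system A := nd_system ndA.

(** The balance says that [b b' + (-1) c] is null.  Hyper-type replaces the four
    factors by tangible elements below them, and tangible elements below -1 and
    [c] are -1 and [c] themselves. *)
Lemma hyper_factor (c : T0 A) (b b' : A) : tv c ∇ ndmul b b' ->
  exists a a' : T0 A, [/\ tv a ⪯ b, tv a' ⪯ b' & c = tmul a a'].
Proof.
have [[bimA negA _] surA _] := hA.
have [e _ [e1 eP]] := negone_ex hA => /(nabla_sym hA) cbb'.
pose u (i : 'I_2) : A := if i == ord0 then b else tv e.
pose v (i : 'I_2) : A := if i == ord0 then b' else tv c.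
have nuv : Null (\sum_(i < 2) ndmul (u i) (v i)).
  rewrite !big_ord_recl big_ord0 addr0 /u /v /=.
  by rewrite (ndmul_lact ndA) (eP _).1.
have [a [a' [le_a]]] := hypA nuv.
rewrite !big_ord_recl big_ord0 addr0.
have [a0 a'0] := le_a ord0; have := le_a (lift ord0 ord0).
rewrite /u /v /= => -[/(sle_tan surA) -> /(sle_tan surA) ->].
rewrite [tv (tmul e c)](tv_tmul_lact bimA) (eP _).1 => /(nabla_tangible hA) <-.
by exists (a ord0), (a' ord0).
Qed.

(** The case [b' = 1] of the factorization: the only tangible element below 1
    is 1. *)
Lemma hyper_nabla_sle (a : T0 A) (b : A) : tv a ∇ b -> tv a ⪯ b.
Proof.
have [[bimA _ _] surA _] := hA.
rewrite -{1}[b](ndmulx1 ndA) => /hyper_factor[c [d [cb /(sle_tan surA) -> ->]]].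
by rewrite (tmulx1 bimA).
Qed.

Lemma hyper_nabla_mul (c : T0 A) (b b' : A) : tv c ∇ ndmul b b' <->
  exists a a' : T0 A, [/\ tv a ∇ b, tv a' ∇ b' & c = tmul a a'].
Proof.
have [[bimA _ _] _ _] := hA; split.
  move=> /hyper_factor[a [a' [ab a'b' ->]]]; exists a, a'.
  by split=> //; apply: (sle_nabla hA).
move=> [a [a' [/hyper_nabla_sle ab /hyper_nabla_sle a'b' ->]]].
apply: (sle_nabla hA); rewrite (tv_tmul_lact bimA) -(ndmul_lact ndA).
exact: (ndmul_sle ndA).
Qed.

End HyperType.

(** * Morphisms to hypersystems *)

Section HsMor.
Variable H : Hp_obj.

(** A hyperring and the balance hyperring of its hypersystem have the same
    iterated hypersums; the binary statement alone would not make [hs_single]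
    and its inverse morphisms. *)
Lemma hsum1_hs_single (s : seq H) :
  @hsum1 (nabla_hyper (hypersystem H)) (map (@hs_single H) s) =
  @hs_single H @` hsum1 s.
Proof.
rewrite (hsum1_nabla (hypersystem_system H) (@hypersystem_balanced H)
  (@hypersystem_elimination H)) big_map.
apply/seteqP; split=> a.
  have [x ->] := hs_singleP a => /hs_nabla_single; rewrite hbar_sumE => xs.
  by exists x.
by case=> x xs <-; apply/hs_nabla_single; rewrite hbar_sumE.
Qed.

Lemma hs_single_mor : @is_hyp_mor H (nabla_hyper (hypersystem H)) (@hs_single H).
Proof.
have [_ h0 h1 hM _] := hs_single_iso H.
by split=> // s; rewrite hsum1_hs_single.
Qed.

Lemma hs_val_mor : @is_hyp_mor (nabla_hyper (hypersystem H)) H (@hs_val H).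
Proof.
have [_ h0 h1 hM _] := hs_single_iso H.
split; try by apply: hs_single_inj; rewrite hs_valK ?h0 ?h1.
  by move=> a b; apply: hs_single_inj; rewrite hs_valK hM !hs_valK.
move=> s _ [a as_ <-]; move: as_; rewrite -{1}[s](mapK (@hs_valK H)).
by rewrite hsum1_hs_single => -[x xs <-]; rewrite hs_singleK.
Qed.

End HsMor.

Section ToHypersystem.
Variables (A : sysdata) (hA : is_system A).
Hypotheses (balA : tangibly_balanced A) (elimA : tangible_balance_elimination A).
Variables (H : Hp_obj) (f : sle_mor A (hypersystem H)).

Let fP : is_sle_mor f (smtan f) := smP f.

Definition hs_restr (a : nabla_hyper A) : H := hs_val (smtan f a).

Lemma hs_restrE (a : T0 A) : f (tv a) = hbar_single (hs_restr a).
Proof. by rewrite (sm_restr fP) -[smtan f a]hs_valK. Qed.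

Lemma hs_restr_hyp_mor : is_hyp_mor hs_restr.
Proof.
have fM := smtan_hyp_mor hA (hypersystem_system H) f balA elimA
  (@hypersystem_balanced H) (@hypersystem_elimination H).
exact: (hyp_mor_compP (HypMor (hs_val_mor H)) (HypMor fM)).
Qed.

Lemma hs_restr_image (b : A) :
  hs_restr @` [set a : nabla_hyper A | tv a ∇ b] `<=` hset (f b).
Proof.
move=> _ [a /= ab <-]; apply/hs_nabla_single; rewrite hs_valK.
exact: (sle_mor_nabla hA (hypersystem_system H)).
Qed.

(** Only the values at tangible [b] matter: there [f b] is a singleton. *)
Lemma hs_restr_unique (h : nabla_hyper A -> H) :
  (forall b : A, h @` [set a : nabla_hyper A | tv a ∇ b] `<=` hset (f b)) ->
  h =1 hs_restr.
Proof.
move=> hf a; have : hset (f (tv a)) (h a).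
  by apply: hf; exists a => //; apply: (nablaxx hA).
by rewrite hs_restrE => ->.
Qed.

Hypothesis nabla_sleA : forall (a : T0 A) (b : A), tv a ∇ b -> tv a ⪯ b.

(** Lifting a singleton below [f b] to a tangible element below [b] is the
    surjectivity of the restriction from the balances of [b] onto [f b]. *)
Lemma lifting_hs_restr : tangible_lifting f <->
  forall b : A, hs_restr @` [set a : nabla_hyper A | tv a ∇ b] = hset (f b).
Proof.
split=> [lift_f b|fE a' b].
  apply/seteqP; split=> [|x fbx]; first exact: hs_restr_image.
  have [|a ab] := lift_f (hs_single x) b; first exact/hs_sle_single.
  rewrite hs_restrE => /hbar_single_inj <-; exists a => //.
  exact: (sle_nabla hA).
have [x ->] := hs_singleP a' => /hs_sle_single; rewrite -fE => -[a ab <-].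
by exists a; [apply: nabla_sleA | rewrite hs_restrE].
Qed.

Lemma lifting_hyp_mor : tangible_lifting f <->
  exists h : hyp_mor (nabla_hyper A) H,
    forall b : A, h @` [set a : nabla_hyper A | tv a ∇ b] = hset (f b).
Proof.
rewrite lifting_hs_restr; split=> [fE|[h hE] b].
  by exists (HypMor hs_restr_hyp_mor).
rewrite -hE; apply: eq_imagel => a _; apply/esym/hs_restr_unique => {}b.
by rewrite hE.
Qed.

Lemma unique_hyp_mor : exists! h : hyp_mor (nabla_hyper A) H,
  forall b : A, h @` [set a : nabla_hyper A | tv a ∇ b] `<=` hset (f b).
Proof.
exists (HypMor hs_restr_hyp_mor); split; first exact: hs_restr_image.
by move=> h /hs_restr_unique hE; apply: hyp_mor_ext => a; rewrite hE.
Qed.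

End ToHypersystem.

Section BetweenHypersystems.
Variables (H H' : Hp_obj) (g : sle_mor (hypersystem H) (hypersystem H')).

Let hA := hypersystem_system H.
Let balA := @hypersystem_balanced H.
Let elimA := @hypersystem_elimination H.

(** When the source is a hypersystem too, its tangible elements are identified
    with the elements of the hyperring. *)
Definition hs_desc (x : H) : H' := hs_restr g (hs_single x).

Lemma hs_descE (x : H) : g (hbar_single x) = hbar_single (hs_desc x).
Proof. exact: (hs_restrE g (hs_single x)). Qed.

Lemma hs_desc_hyp_mor : is_hyp_mor hs_desc.
Proof.
exact: (hyp_mor_compP (HypMor (hs_restr_hyp_mor hA balA elimA g))
  (HypMor (hs_single_mor H))).
Qed.

Lemma hs_desc_imageE (S : hypersystem H) : hs_desc @` hset S =
  hs_restr g @` [set a : nabla_hyper (hypersystem H) | tv a ∇ S].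
Proof.
rewrite /hs_desc -(image_comp (@hs_single H) (hs_restr g)); congr image.
apply/seteqP; split=> a.
  by case=> x Sx <-; apply/hs_nabla_single.
by have [x ->] := hs_singleP a => /hs_nabla_single Sx; exists x.
Qed.

Lemma hs_desc_unique (h : H -> H') :
  (forall S : hbar H, h @` hset S `<=` hset (g S)) -> h =1 hs_desc.
Proof.
move=> hg x; have : hset (g (hbar_single x)) (h x) by apply: hg; exists x.
by rewrite hs_descE => ->.
Qed.

Lemma lifting_hs_desc : tangible_lifting g <->
  forall S : hbar H, hs_desc @` hset S = hset (g S).
Proof.
rewrite (lifting_hs_restr hA) => [|a S]; last first.
  have [x ->] := hs_singleP a.
  by move=> /hs_nabla_single/hs_sle_single.
by split=> gE S; rewrite -gE hs_desc_imageE.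
Qed.

Lemma unique_hs_desc : exists! f : hyp_mor H H',
  forall S : hbar H, f @` hset S `<=` hset (g S).
Proof.
exists (HypMor hs_desc_hyp_mor); split=> [S|h /hs_desc_unique hE].
  by rewrite [X in X `<=` _]hs_desc_imageE; apply: hs_restr_image.
by apply: hyp_mor_ext => x; rewrite hE.
Qed.

Lemma lifting_desc_hyp_mor : tangible_lifting g <->
  exists f : hyp_mor H H', forall S : hbar H, f @` hset S = hset (g S).
Proof.
rewrite lifting_hs_desc; split=> [gE|[f fE] S].
  by exists (HypMor hs_desc_hyp_mor).
rewrite -fE; apply: eq_imagel => x _; apply/esym/hs_desc_unique => S'.
by rewrite fE.
Qed.

End BetweenHypersystems.

(** * The two functors *)

Lemma TBSr_system (A : TBSr) : is_system A.
Proof. exact: nd_system (TBSr_nd (tbP A)). Qed.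

Lemma TBSr_nabla_sle (A : TBSr) (a : T0 A) (b : A) : tv a ∇ b -> tv a ⪯ b.
Proof. exact: hyper_nabla_sle (TBSr_nd (tbP A)) (TBSr_hyp (tbP A)) _ _. Qed.

Lemma nabla_hyper_Hp (A : TBSr) : is_Hp (nabla_hyper A).
Proof.
split; last by apply: tone_neq0; case: (TBSr_system A) => -[].
exact: (nabla_hyperring (TBSr_system A) (TBSr_bal (tbP A)) (TBSr_elim (tbP A))
  (TBSr_inv (tbP A))).
Qed.

Lemma smtan_Hp (A B : TBSr) (f : mor A B) :
  @is_hyp_mor (nabla_hyper A) (nabla_hyper B) (smtan f).
Proof.
exact: (smtan_hyp_mor (TBSr_system A) (TBSr_system B) f (TBSr_bal (tbP A))
  (TBSr_elim (tbP A)) (TBSr_bal (tbP B)) (TBSr_elim (tbP B))).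
Qed.

Section HypersystemHyperType.
Variable H : HpS_obj.

(** A member of a finite sum of sets is a member of the hypersum of one chosen
    element in each of them. *)
Lemma hyper_choice (n : nat) (S : 'I_n -> hbar H) (z : H) :
  hset (\sum_(i < n) S i) z -> exists2 x : 'I_n -> H,
    forall i, hset (S i) (x i) & hset (\sum_(i < n) hbar_single (x i)) z.
Proof.
elim: n S z => [|n IH] S z.
  rewrite big_ord0 => z0; exists (fun=> z); first by case.
  by rewrite big_ord0.
rewrite big_ord_recl => /setaddP[x0 [y [Sx0 /IH[x Sx xy] x0yz]]].
exists (fun i => if unlift ord0 i is Some j then x j else x0).
  by move=> i; case: unliftP => [j|] ->.
rewrite big_ord_recl unlift_none; apply/setaddP; exists x0, y; split=> //.
by under eq_bigr do rewrite liftK.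
Qed.

(** A null sum of products contains 0; choosing one element in each product that
    contributes to this 0, and its two factors, gives the tangible elements
    required. *)
Lemma nd_hypersystem_hyper_type : hyper_type (nd_hypersystem H).
Proof.
move=> n S S' /hs_nullE /hyper_choice[x xP x0].
pose factors i (y : H * H) :=
  [/\ hset (S i) y.1, hset (S' i) y.2 & hmul y.1 y.2 = x i].
have [|y yP] := @choice _ _ factors.
  by move=> i; have [u Su [v Sv uv]] := xP i; exists (u, v).
exists (fun i => hs_single (y i).1), (fun i => hs_single (y i).2); split=> [i|].
  by have [? ? _] := yP i; split; apply/hs_sle_single.
apply/hs_nullE; move: x0; congr (hset _ _); apply: eq_bigr => i _.
by rewrite hs_tmulE; have [_ _ ->] := yP i.
Qed.

Lemma nd_hypersystem_nd : is_nd_semiring_system (nd_hypersystem H).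
Proof.
have hM := (hpP H).1.1.1.
have hsys := hypersystem_system H; have [[bim _ _] _ _] := hsys.
have mull (a : T0 (nd_hypersystem H)) (S : nd_hypersystem H) : ndmul (tv a) S = a *l S.
  exact: hbar_ext.
have mulr (a : T0 (nd_hypersystem H)) (S : nd_hypersystem H) : ndmul S (tv a) = S *r a.
  exact: hbar_ext.
split=> //.
- move=> S1 S2 S3; apply: hbar_ext; apply/seteqP; split=> w /=.
    move=> [x Sx [_ [y Sy [z Sz <-]] <-]]; rewrite (hmulA hM).
    by exists (hmul x y); [exists x => //; exists y | exists z].
  move=> [_ [x Sx [y Sy <-]] [z Sz <-]]; rewrite -(hmulA hM).
  by exists x => //; exists (hmul y z) => //; exists y => //; exists z.
- by move=> S; rewrite mull (lact1x bim).
- by move=> S; rewrite mulr (ractx1 bim).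
- by move=> S; rewrite -[RHS](lact0x bim S); apply: (mull (tzero _)).
- by move=> S; rewrite -[RHS](ractx0 bim S); apply: (mulr (tzero _)).
- move=> S1 S2 S1' S2'; rewrite !hs_sleE => h1 h2 z.
  by case=> x /h1 Sx [y /h2 Sy <-]; exists x => //; exists y.
Qed.

Lemma nd_hypersystem_TBSr : is_TBSr (nd_hypersystem H).
Proof.
split; [exact: nd_hypersystem_nd | exact: hypersystem_balanced
  | exact: hypersystem_elimination | exact: hypersystem_inversion
  | exact: nd_hypersystem_hyper_type].
Qed.

End HypersystemHyperType.

Lemma Phi_tan_single (H H' : HpS) (f : mor H H') (x : hps H) :
  Phi_tan f (hs_single x) = hs_single (sval f x).
Proof. by apply: val_inj; apply: hbar_ext; rewrite /= image_set1. Qed.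

Lemma hyp_mor_setadd (H H' : Hp_obj) (f : hyp_mor H H') (S S' : set H) :
  f @` setadd S S' `<=` setadd (f @` S) (f @` S').
Proof.
have hG := hypergroupP (hpP H).1.1.1; have hG' := hypergroupP (hpP H').1.1.1.
move=> _ [z /setaddP[x [y [Sx S'y xyz]]] <-].
have : hsum1 [:: f x; f y] (f z).
  apply: (hm_sum (hmP f) (s := [:: x; y])); exists z => //.
  rewrite (hsum1_cat hG [:: _] [:: _]) !(hsum1_1 hG).
  by apply/setaddP; exists x, y.
rewrite (hsum1_cat hG' [:: _] [:: _]) !(hsum1_1 hG').
move=> /setaddP[_ [_ [-> -> h]]]; apply/setaddP.
by exists (f x), (f y); split.
Qed.

Lemma Phi_fun_sle_mor (H H' : HpS) (f : mor H H') :
  @is_sle_mor (hypersystem H) (hypersystem H') (Phi_fun f) (Phi_tan f).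
Proof.
have [f0 f1 fM _] := hmP (sval f).
split.
- by [].
- by apply: hbar_ext; rewrite /= image_set1 f0.
- by rewrite /= Phi_tan_single f1.
- move=> a b; have [[x ->] [y ->]] := (hs_singleP a, hs_singleP b).
  by rewrite hs_tmulE !Phi_tan_single hs_tmulE fM.
- move=> a S; have [x ->] := hs_singleP a.
  apply: hbar_ext; rewrite Phi_tan_single hs_lactE /= setmul1l !image_comp.
  by apply: eq_imagel => y _ /=; rewrite fM.
- move=> a S; have [x ->] := hs_singleP a.
  apply: hbar_ext; rewrite Phi_tan_single hs_ractE /= setmul1r !image_comp.
  by apply: eq_imagel => y _ /=; rewrite fM.
- by move=> S S'; rewrite !hs_sleE; apply: image_subset.
- by move=> S S'; rewrite hs_sleE; apply: hyp_mor_setadd.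
Qed.

Lemma Phi_fun_lifting (H H' : HpS) (f : mor H H') :
  @tangible_lifting (hypersystem H) (hypersystem H') (Phi_fun f).
Proof.
move=> a' S; have [x' ->] := hs_singleP a'.
move=> /hs_sle_single[x Sx <-]; exists (hs_single x); first exact/hs_sle_single.
by apply: hbar_ext; rewrite /= image_set1.
Qed.

(** * The reflection *)

Section Reflection.
Variable A : TBSr.

Let hA : is_system A := TBSr_system A.
Let balA : tangibly_balanced A := TBSr_bal (tbP A).
Let elimA : tangible_balance_elimination A := TBSr_elim (tbP A).

Lemma balanced_hsum1 (b : A) :
  exists s, [set a : nabla_hyper A | tv a ∇ b] = hsum1 s.
Proof.
have [[bimA _ _] _ _] := hA; have [s ->] := tang_gen bimA b.
by exists s; rewrite (hsum1_nabla hA balA elimA).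
Qed.

Lemma hbar_nabla (S : hbar (nabla_hyper A)) :
  exists b : A, hset S = [set a : nabla_hyper A | tv a ∇ b].
Proof.
have [s ->] := hsetP S; exists (\sum_(x <- s) tv x).
exact: hsum1_nabla.
Qed.

Definition nabla_Hp : Hp_obj := HpObj (nabla_hyper_Hp A).

(** This is where hyper-type enters the construction of the reflection: the
    product of the balances of [b] and [b'] is the set of balances of the
    element [b b'], which is a sum of tangible elements because these
    generate. *)
Lemma nabla_mul_closed : mul_closed nabla_Hp.
Proof.
move=> S S'; have [[b Sb] [b' S'b']] := (hbar_nabla S, hbar_nabla S').
have [s bs] := balanced_hsum1 (ndmul b b'); exists s; rewrite -bs Sb S'b'.
have mulE := hyper_nabla_mul (TBSr_nd (tbP A)) (TBSr_hyp (tbP A)).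
apply/seteqP; split=> c.
  by case=> a ab [a' a'b' <-]; apply/mulE; exists a, a'.
by case/mulE=> a [a' [ab a'b' ->]]; exists a => //; exists a'.
Qed.

Definition nabla_HpS : HpS := HpSObj nabla_mul_closed.

Definition balances (b : A) : hypersystem nabla_Hp := Hbar (balanced_hsum1 b).

Lemma balances_tan (a : T0 A) : balances (tv a) = hbar_single (a : nabla_Hp).
Proof.
apply: hbar_ext; apply/seteqP; split=> c /=; first exact: (nabla_tangible hA).
by move=> ->; apply: (nablaxx hA).
Qed.

(** Compatibility with the actions is ∇-inversion, and subadditivity is
    interpolation, applied to both summands. *)
Lemma balances_sle_mor :
  @is_sle_mor A (hypersystem nabla_Hp) balances (fun a => hs_single (a : nabla_Hp)).
Proof.
have [[bimA _ _] _ _] := hA; have [invl invr] := TBSr_inv (tbP A).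
split.
- exact: balances_tan.
- exact: (balances_tan (tzero A)).
- by [].
- by move=> a b; rewrite hs_tmulE.
- move=> a b; apply: hbar_ext; rewrite hs_lactE; apply/seteqP; split=> c /=.
    move=> /(nabla_sym hA)/invl[d [<- bd]]; exists d => //.
    exact: nabla_sym.
  by case=> d db <-; rewrite (tv_tmul_lact bimA); apply: nabla_lact.
- move=> a b; apply: hbar_ext; rewrite hs_ractE; apply/seteqP; split=> c /=.
    move=> /(nabla_sym hA)/invr[d [<- bd]]; exists d => //.
    exact: nabla_sym.
  by case=> d db <-; rewrite (tv_tmul_ract bimA); apply: nabla_ract.
- move=> b b' bb'; rewrite hs_sleE => a /= ab.
  exact: (nabla_sle hA ab bb').
- move=> b b'; rewrite hs_sleE => c /=.
  move=> /(nabla_interpolation hA balA elimA)[x xb].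
  rewrite addrC => /(nabla_interpolation hA balA elimA)[y yb' cyx].
  apply/setaddP; exists x, y; split=> //.
  by rewrite [hadd _ _](hadd_nabla x y) /= addrC.
Qed.

Lemma balances_lifting : @tangible_lifting A (hypersystem nabla_Hp) balances.
Proof.
move=> a' b; have [a ->] := hs_singleP a' => /hs_sle_single ab.
by exists a; [apply: TBSr_nabla_sle | rewrite balances_tan].
Qed.

End Reflection.

(** * Full reflectivity of the hypersystem functor *)

Notation PhiT := (Phi nd_hypersystem_TBSr Phi_fun_sle_mor Phi_fun_lifting).

Lemma Phi_faithful : faithful PhiT.
Proof.
move=> H H' f g fg; apply: subcat_ext; apply: hyp_mor_ext => x.
apply: hs_single_inj; rewrite -!Phi_tan_single.
exact: (congr1 (fun h : @mor TBSrL (PhiT H) (PhiT H') =>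
  smtan (sval h) (hs_single x)) fg).
Qed.

(** The restriction [hs_desc g] satisfies [hs_desc g @` S = g S] by lifting; in
    particular these images are finite hypersums, so that it lies in the
    subcategory. *)
Lemma Phi_full : full PhiT.
Proof.
move=> H H' [g lift_g].
have /lifting_hs_desc gE := lift_g.
have fP := hs_desc_hyp_mor g.
have fS : image_closed (hs_desc g) by move=> S; rewrite gE; apply: hsetP.
exists (exist _ (HypMor fP) fS : mor H H').
by apply: subcat_ext; apply: sle_mor_ext => S; apply: hbar_ext; rewrite -gE.
Qed.

(** The factorization of [f] is its restriction [h] to tangible elements: every
    finite hypersum of balances has the form [{a | a ∇ b}], and [h] maps it onto
    [f b].  Uniqueness follows by evaluating at tangible [b]. *)
Lemma Phi_reflective : reflective PhiT.
Proof.
move=> A; exists (nabla_HpS A).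
pose r : mor A (PhiT (nabla_HpS A)) := exist _
  (SleMor (balances_sle_mor A) : @mor TBSr A (PhiT (nabla_HpS A)))
  (@balances_lifting A).
exists r => H [f lift_f].
have /(lifting_hs_restr (TBSr_system A) _ (@TBSr_nabla_sle A)) fE := lift_f.
have hP := hs_restr_hyp_mor (TBSr_system A) (TBSr_bal (tbP A)) (TBSr_elim (tbP A)) f.
have hS : @image_closed (nabla_Hp A) H (hs_restr f).
  by move=> S; have [b ->] := hbar_nabla S; rewrite fE; apply: hsetP.
exists (exist _ (HypMor hP) hS : mor (nabla_HpS A) H); split.
  by apply: subcat_ext; apply: sle_mor_ext => b; apply: hbar_ext; rewrite /= fE.
move=> [h' hS'] /(congr1 (fun u => smfun (sval u))) /= f_h'.
apply: subcat_ext; apply: hyp_mor_ext => a /=.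
apply: hbar_single_inj; rewrite -hs_restrE f_h' /= balances_tan.
by apply: hbar_ext; rewrite /= image_set1.
Qed.

Theorem theorem5p32 :
  (forall A : sysdata, is_system A -> tangibly_balanced A ->
     tangible_balance_elimination A ->
     [/\ is_multiring (nabla_hyper A),
         forall S : seq (set (nabla_hyper A)), hsum S = boxnabla S &
         nabla_inversion A -> is_hyperring (nabla_hyper A)])
  /\
  (forall H : Hp,
     [/\ is_system (hypersystem H),
         tangibly_balanced (hypersystem H),
         tangible_balance_elimination (hypersystem H),
         nabla_inversion (hypersystem H) &
         @is_hyp_iso H (nabla_hyper (hypersystem H)) (@hs_single H)])
  /\
  (exists (PsiO : forall A : TBSr, is_Hp (nabla_hyper A))
          (PsiM : forall (A B : TBSr) (f : mor A B),
             @is_hyp_mor (nabla_hyper A) (nabla_hyper B) (smtan f))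
          (PhiO : forall H : HpS, is_TBSr (nd_hypersystem H))
          (PhiM : forall (H H' : HpS) (f : mor H H'),
             @is_sle_mor (hypersystem H) (hypersystem H')
               (Phi_fun f) (Phi_tan f))
          (PhiL : forall (H H' : HpS) (f : mor H H'),
             @tangible_lifting (hypersystem H) (hypersystem H') (Phi_fun f)),
     (forall (H H' : HpS) (f : mor H H') (x : hps H),
        hmfun (fmor (Psi PsiO PsiM) (sval (fmor (Phi PhiO PhiM PhiL) f)))
          (hs_single x) = hs_single (hmfun (sval f) x))
     /\ full_reflective (Phi PhiO PhiM PhiL))
  /\
  (forall (A : TBSr) (H : Hp) (f : sle_mor A (hypersystem H)),
     (exists! h : hyp_mor (nabla_hyper A) H,
        forall b : A, h @` [set a : nabla_hyper A | tv a ∇ b] `<=` hset (f b))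
     /\
     (tangible_lifting f <->
      exists h : hyp_mor (nabla_hyper A) H,
        forall b : A, h @` [set a : nabla_hyper A | tv a ∇ b] = hset (f b)))
  /\
  (forall (H H' : Hp) (g : sle_mor (hypersystem H) (hypersystem H')),
     (exists! f : hyp_mor H H',
        forall S : hbar H, f @` hset S `<=` hset (g S))
     /\
     (tangible_lifting g <->
      exists f : hyp_mor H H',
        forall S : hbar H, f @` hset S = hset (g S))).
Proof.
split; last split; last split; last split.
- move=> A hA balA elimA; split; [exact: nabla_multiring | exact: hsum_boxnabla
    | exact: nabla_hyperring].
- move=> H; split; [exact: hypersystem_system | exact: hypersystem_balanced
    | exact: hypersystem_elimination | exact: hypersystem_inversion
    | exact: hs_single_iso].
- exists nabla_hyper_Hp, smtan_Hp, nd_hypersystem_TBSr, Phi_fun_sle_mor, Phi_fun_lifting.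
  split; first exact: Phi_tan_single.
  by split; [exact: Phi_faithful | exact: Phi_full | exact: Phi_reflective].
- move=> A H f; split.
    exact: (unique_hyp_mor (TBSr_system A) (TBSr_bal (tbP A)) (TBSr_elim (tbP A))).
  exact: (lifting_hyp_mor (TBSr_system A) (TBSr_bal (tbP A)) (TBSr_elim (tbP A)) f
    (@TBSr_nabla_sle A)).
- move=> H H' g; split; [exact: unique_hs_desc | exact: lifting_desc_hyp_mor].
Qed.
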